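(* Let $n\ge 1$, let $S\subset[n]^2$ be admissible, let $\bar A\in\mathscr{M}_S$ with $\|\bar A\|_{\max}\le 1$, let $\sigma>0$, and let $A\sim N_S(\bar A,\sigma^2\mathrm{Id})$. Then, for every real number $t>|S|$, $$\mathrm{Prob}\{\boldsymbol{c}^{\mathsf{det}}(A)>t\}<\left(\frac{1+\sigma}{\sigma}\right)\left(\frac{|S|^2}{t-|S|}\right)\sqrt{\frac{2}{\pi}},$$ and, for all $\beta>1$, $$\mathbb{E}\big(\log_\beta \boldsymbol{c}^{\mathsf{det}}(A)\big)<\log_\beta\left(\frac{1+\sigma}{\sigma}\right)+2\log_\beta|S|+\frac{1.03}{\ln\beta}.$$
   Context: Notation: $[n]=\{1,\dots,n\}$; $\mathscr{M}$ is the set of $n\times n$ real matrices; for $S\subseteq[n]^2$, $\mathscr{M}_S=\{A\in\mathscr{M}: a_{ij}=0 \text{ whenever } (i,j)\notin S\}$. The set $S$ is admissible if $\mathscr{M}_S$ contains some invertible matrix. $\|A\|_{\max}=\max_{i,j}|a_{ij}|$. Random sparse matrices: $A\sim N_S(\bar A,\sigma^2\mathrm{Id})$ means that the entries $a_{ij}$ with $(i,j)\in S$ are independent Gaussian random variables $a_{ij}\sim N(\bar a_{ij},\sigma^2)$, and $a_{ij}=0$ for $(i,j)\notin S$. Componentwise condition number: For $u,v\in\mathbb{R}^p$ let $\frac{u}{v}=(w_1,\dots,w_p)$ with $w_i=u_i/v_i$ if $v_i\ne 0$, $w_i=0$ if $u_i=v_i=0$, and $w_i=\infty$ otherwise. Put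 $d(u,v)=\left\|\frac{u-v}{v}\right\|_\infty\in[0,\infty]$; when finite, $d(u,v)=\min\{\nu\ge 0: |u_i-v_i|\le\nu|v_i| \text{ for all } i\}$. For $\delta>0$ let $\mathcal{S}(a,\delta)=\{x\in\mathbb{R}^p: d(x,a)\le\delta\}$. For a continuous map $F:\mathcal{D}\to\mathbb{R}^q$, $\mathcal{D}\subseteq\mathbb{R}^p$, and $a\in\mathcal{D}$, the componentwise condition number of $F$ at $a$ is $$\boldsymbol{c}^F(a)=\lim_{\delta\to 0}\ \sup_{x\in\mathcal{S}(a,\delta)\cap\mathcal{D},\ x\ne a}\frac{d(F(x),F(a))}{d(x,a)}\in[0,\infty].$$ The quantity $\boldsymbol{c}^{\mathsf{det}}(A)$ is the componentwise condition number at $A$ of the map $F(A)=\det(A)$ on $\mathscr{M}$ (identified with $\mathbb{R}^{n^2}$). *)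

(* Defs.v *)
From HB Require Import structures.
From mathcomp Require Import all_boot all_order all_algebra.
From mathcomp Require Import all_classical all_reals all_analysis.
Set Implicit Arguments.
Unset Strict Implicit.
Unset Printing Implicit Defensive.
Import Order.TTheory GRing.Theory Num.Theory.
Import numFieldNormedType.Exports.
Local Open Scope classical_set_scope.
Local Open Scope ring_scope.

Section ComponentwiseCondition.
Context {R : realType}.

Definition comp_quot (a b : R) : \bar R :=
  if b != 0 then (a / b)%:E else if a == 0 then 0%E else +oo%E.

Definition comp_dist p (u v : 'rV[R]_p) : \bar R :=
  (\big[maxe/0]_(i < p) `|comp_quot ((u - v)%R 0%R i) (v 0%R i)|)%E.

Definition comp_ball p (a : 'rV[R]_p) (delta : R) : set 'rV[R]_p :=
  [set x | (comp_dist x a <= delta%:E)%E].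

(* The supremum is taken in [0, +oo]: inserting 0 makes it 0, not -oo, when
   no x competes (e.g. for a = 0). The quotients are all nonnegative and
   0 < comp_dist x a <= delta, so inserting 0 has no other effect. *)
Definition comp_cond p q (D : set 'rV[R]_p) (F : 'rV[R]_p -> 'rV[R]_q)
    (a : 'rV[R]_p) : \bar R :=
  lim (ereal_sup (0%E |`
         [set (comp_dist (F x) (F a) / comp_dist x a)%E |
            x in comp_ball a delta `&` D `\ a])
       @[delta --> (0 : R)^'+]).

(* 'M_n is identified with R^(n * n) through mxvec. *)
Definition cond_det n (A : 'M[R]_n) : \bar R :=
  comp_cond setT (fun x : 'rV[R]_(n * n) => \row_(_ < 1) \det (vec_mx x))
    (mxvec A).

End ComponentwiseCondition.

Section SparseMatrices.
Context {R : realType} {n : nat}.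
Implicit Types S : {set 'I_n * 'I_n}.

Definition sparse_mx S : set 'M[R]_n :=
  [set A | forall i j, (i, j) \notin S -> A i j = 0].

Definition admissible S : Prop :=
  exists A : 'M[R]_n, sparse_mx S A /\ A \in unitmx.

End SparseMatrices.
Arguments admissible R {n} S.

Section RandomMatrices.
Context d (T : measurableType d) (R : realType) (P : probability T R).

Definition mutually_independent (I : finType) (K : {set I})
    (X : I -> {RV P >-> R}) : Prop :=
  forall (J : {set I}) (B : I -> set R), J \subset K ->
    (forall i, i \in J -> measurable (B i)) ->
    P (\bigcap_(i in [set` J]) X i @^-1` B i) =
    (\prod_(i in J) P (X i @^-1` B i))%E.

Definition rand_mx n (A : 'I_n -> 'I_n -> {RV P >-> R}) (w : T) : 'M[R]_n :=
  \matrix_(i, j) A i j w.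

(* The law of an entry is only compared on measurable sets: the value of a
   measure on other sets is irrelevant junk. In normal_prob m s, s is the
   standard deviation. *)
Definition sparse_gaussian n (S : {set 'I_n * 'I_n}) (Abar : 'M[R]_n)
    (sigma : R) (A : 'I_n -> 'I_n -> {RV P >-> R}) : Prop :=
  [/\ forall i j, (i, j) \in S -> forall B : set R, measurable B ->
        distribution P (A i j) B = normal_prob (Abar i j) sigma B,
      mutually_independent S (fun ij => A ij.1 ij.2)
    & forall w, sparse_mx S (rand_mx A w)].

End RandomMatrices.

(* lne is total: lne 0 = -oo and lne +oo = +oo. *)
Definition loge {R : realType} (beta : R) (x : \bar R) : \bar R :=
  (lne x / (ln beta)%:E)%E.

Definition logr {R : realType} (beta x : R) : R := ln x / ln beta.

(* Main.v *)
Require Import Defs.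
From HB Require Import structures.
From mathcomp Require Import all_boot all_order all_algebra.
From mathcomp Require Import all_classical all_reals all_analysis.
From mathcomp Require Import perm measurable_realfun zify ring lra.
Set Implicit Arguments.
Unset Strict Implicit.
Unset Printing Implicit Defensive.
Import Order.TTheory GRing.Theory Num.Theory.
Import numFieldNormedType.Exports.
Local Open Scope classical_set_scope.
Local Open Scope ring_scope.

(** The determinant is affine in each entry: expanding along row i gives
    det A = A i j * C i j + (terms free of A i j), C i j being the cofactor.
    To first order in relative perturbations of the entries, det A therefore
    moves by at most the sum of the |A i j * C i j|, with equality when the
    signs of the perturbations match those of the terms. Hence at a regular
    matrix the condition number is the sum of the |A i j * C i j| divided by
    |det A| ([cond_det_regular]). At a singular matrix it is 0 or +oo
    ([cond_det_singular]); this happens with probability zero, but the value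
    is needed for the condition number to be a measurable function.

    Tail. If the |S| terms |A i j * C i j| add up to more than t * |det A|,
    one of them exceeds tau * |det A| with tau = t / |S|. Freeze all entries
    but x = A i j: then det A = x * a + b with a, b fixed, and the event reads
    tau * |x - c| < |x| with c = - b / a. Such x lie between L and
    L (tau + 1) / (tau - 1) on one side of 0, an interval of length
    2 L / (tau - 1) on which the Gaussian density is at most K / L, where K
    bounds |y| times the density at y. So L cancels, and the probability is at
    most 2 K / (tau - 1) ([normal_prob_ratio_le]). A mean of absolute value at
    most 1 gives a K slightly below (1 + sigma) / (sigma * sqrt (2 pi)), which
    makes the final bound strict. Freezing the other entries is legitimate
    because, by independence, x and the sigma-algebra generated by the others
    have a product law ([probability_sections_le]); a union bound over S ends
    the argument ([tail_event_le]).

    Regularity. Start from an invertible matrix with pattern S and replace its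
    entries by the random ones, one at a time. The determinant is affine in the
    new entry and nonzero for the old value, hence vanishes for at most one
    value, which has Gaussian probability zero ([rand_det_null]).

    Expectation. A variable Z >= 1 with P(Z > t) <= B / (t - m) for t > m
    satisfies E(ln Z) <= ln B + 1 + m / (2 B): integrate P(Z > t) / t from
    B + m on, where the tail bound reaches 1 ([integral_ln_le]). For m = |S|
    and the above B this is below the claim once |S| >= 3
    ([log_constant_lt]). Otherwise |S| = n, a regular matrix with pattern S has
    one nonzero entry per row, and its condition number is exactly n
    ([det_cond_size]). *)

(** * First-order expansion of the determinant *)

(** The cruder first estimate is what makes the induction for the second one go
    through. *)
Lemma prod1D_linear_error (R : realType) (I : Type) (s : seq I) (e : I -> R)
    (r : R) :
  0 <= r <= 1 -> (forall i, `|e i| <= r) ->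
  `|\prod_(i <- s) (1 + e i) - 1| <= (2 ^+ size s - 1) * r /\
  `|\prod_(i <- s) (1 + e i) - 1 - \sum_(i <- s) e i| <= 2 ^+ size s * r ^+ 2.
Proof.
move=> /andP[r0 r1] er; elim: s => [|i s [IH1 IH2]] /=.
  by rewrite !big_nil !subrr normr0 mul0r mul1r sqr_ge0.
rewrite !big_cons exprS.
set p := \prod_(j <- s) _ in IH1 IH2 *; set t := \sum_(j <- s) _ in IH2 *.
have : 1 <= 2 ^+ size s :> R by rewrite exprn_ege1 // ler1n.
set c := 2 ^+ size s in IH1 IH2 * => c1.
have e1 := er i.
have h : `|e i * (p - 1)| <= r * ((c - 1) * r).
  by rewrite normrM ler_pM.
have h2 : r * ((c - 1) * r) <= (c - 1) * r.
  by rewrite ler_piMl // mulr_ge0 // subr_ge0.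
split.
  have -> : (1 + e i) * p - 1 = (p - 1) + e i * (p - 1) + e i by ring.
  apply: (le_trans (ler_normD _ _)); apply: (le_trans (lerD (ler_normD _ _) e1)).
  apply: (le_trans (lerD (lerD IH1 h) (lexx r))); lra.
have -> : (1 + e i) * p - 1 - (e i + t) = (p - 1 - t) + e i * (p - 1) by ring.
apply: (le_trans (ler_normD _ _)); apply: (le_trans (lerD IH2 h)).
by have := sqr_ge0 r; lra.
Qed.

Section det_expansion.
Context {R : realType} {n : nat}.
Implicit Types A X E B : 'M[R]_n.

Definition laplace_term A i j := A i j * cofactor A i j.

Lemma sum_laplace_term A i : \sum_j laplace_term A i j = \det A.
Proof. by rewrite (expand_det_row A i). Qed.

(** Summing over permutations turns a sum of E i j * laplace_term A i j into
    the linear part of the Leibniz formula under relative perturbations E. *)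
Lemma laplace_termE A i j :
  laplace_term A i j = \sum_(s : 'S_n | s i == j) (-1) ^+ s * \prod_k A k (s k).
Proof.
rewrite /laplace_term expand_cofactor big_distrr /=; apply: eq_bigr => s /eqP <-.
rewrite [in RHS](bigD1 i) //= mulrCA; congr (_ * (_ * _)).
by apply: eq_bigl => k; rewrite eq_sym.
Qed.

(** In the Leibniz formula a relative perturbation E multiplies the product of
    a permutation s by the product of the 1 + E i (s i); each is replaced by
    its linearization. *)
Lemma det_relative_linear_error A : exists2 K : R, 0 <= K &
  forall E r, 0 <= r <= 1 -> (forall i j, `|E i j| <= r) ->
  `|\det (\matrix_(i, j) (A i j * (1 + E i j))) - \det A
    - \sum_i \sum_j E i j * laplace_term A i j| <= K * r ^+ 2.
Proof.
exists (\sum_(s : 'S_n) `|\prod_k A k (s k)| * 2 ^+ n).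
  by apply: sumr_ge0 => s _; rewrite mulr_ge0.
move=> E r r01 Er.
have -> : \sum_i \sum_j E i j * laplace_term A i j =
    \sum_(s : 'S_n) (-1) ^+ s * \prod_k A k (s k) * \sum_i E i (s i).
  under eq_bigr => i _ do under eq_bigr => j _ do
    rewrite laplace_termE big_distrr /=.
  under eq_bigr => i _.
    rewrite (exchange_big_dep predT) //=.
    under eq_bigr => s _ do rewrite (big_pred1 (s i)) 1?(@eq_sym _ _ (s i)) //.
    over.
  rewrite exchange_big /=; apply: eq_bigr => s _; rewrite big_distrr /=.
  by apply: eq_bigr => i _; rewrite mulrC.
have -> : \det (\matrix_(i, j) (A i j * (1 + E i j))) =
    \sum_(s : 'S_n) (-1) ^+ s * \prod_k A k (s k) * \prod_i (1 + E i (s i)).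
  apply: eq_bigr => s _; rewrite -mulrA -big_split /=; congr (_ * _).
  by apply: eq_bigr => i _; rewrite mxE.
rewrite /determinant -!sumrB; apply: (le_trans (ler_norm_sum _ _ _)).
rewrite big_distrl /=; apply: ler_sum => s _.
set p := \prod_k _; set q := \prod_i _; set t := \sum_i _.
have -> : (-1) ^+ s * p * q - (-1) ^+ s * p - (-1) ^+ s * p * t =
    (-1) ^+ s * p * (q - 1 - t) by rewrite !mulrBr mulr1.
rewrite !normrM normrX normrN1 expr1n mul1r -mulrA; apply: ler_wpM2l => //.
have [_] := prod1D_linear_error (index_enum 'I_n) (e := fun i => E i (s i)) r01
  (fun i => Er _ _).
by rewrite /index_enum -enumT size_enum_ord big_enum big_enum.
Qed.

End det_expansion.

(** * Componentwise condition number of the determinant *)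

Section cond_det_formula.
Context {R : realType}.

Lemma comp_quot_le (u v r : R) : 0 <= r ->
  (`|comp_quot (u - v) v| <= r%:E)%E = (`|u - v| <= r * `|v|).
Proof.
move=> r0; rewrite /comp_quot; have [->|v0] /= := eqVneq v 0.
  rewrite normr0 mulr0 subr0 normr_le0; case: eqVneq => _ /=.
    by rewrite normr0 lee_fin r0.
  by rewrite leye_eq.
by rewrite lee_fin normrM normfV ler_pdivrMr // normr_gt0.
Qed.

Lemma comp_dist_le p (u v : 'rV[R]_p) (r : R) : 0 <= r ->
  (comp_dist u v <= r%:E)%E <-> forall i, `|u 0 i - v 0 i| <= r * `|v 0 i|.
Proof.
move=> r0; rewrite /comp_dist; split.
  move=> h i; have := comp_quot_le (u 0 i) (v 0 i) r0 => <-.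
  apply: le_trans h; rewrite [leRHS](bigD1 i) //= le_max.
  by rewrite !mxE lexx.
move=> h; apply/bigmax_leP; split => [|i _]; first by rewrite lee_fin.
by rewrite !mxE comp_quot_le.
Qed.

Lemma comp_dist_ge0 p (u v : 'rV[R]_p) : (0 <= comp_dist u v)%E.
Proof. by rewrite /comp_dist; elim/big_ind: _ => // x y x0 y0; rewrite le_max x0. Qed.

Lemma comp_dist_mxvec n (X A : 'M[R]_n) (r : R) : 0 <= r ->
  (comp_dist (mxvec X) (mxvec A) <= r%:E)%E <->
  forall i j, `|X i j - A i j| <= r * `|A i j|.
Proof.
move=> r0; rewrite comp_dist_le //; split => [h i j | h k].
  by have := h (mxvec_index i j); rewrite !mxvecE.
by case/mxvec_indexP: k => i j; rewrite !mxvecE.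
Qed.

(** The value of the condition number at regular matrices: the l1 norm of the
    relative gradient of the determinant. *)
Definition det_cond n (A : 'M[R]_n) : R :=
  (\sum_i \sum_j `|laplace_term A i j|) / `|\det A|.

Lemma comp_dist_fin n (x a : 'rV[R]_n) (delta : R) :
  (comp_dist x a <= delta%:E)%E -> x <> a ->
  exists2 r, 0 < r <= delta & comp_dist x a = r%:E.
Proof.
have := comp_dist_ge0 x a; case E : (comp_dist x a) => [r| |] //=.
rewrite !lee_fin => r0 rd xa; exists r => //; rewrite rd andbT lt_neqAle r0 andbT.
apply/eqP => r0'; apply: xa; apply/rowP => i; apply/eqP.
have [+ _] := comp_dist_le x a r0; rewrite E lexx => /(_ erefl i).
rewrite -r0' mul0r.
by rewrite normr_le0 subr_eq0.
Qed.

Lemma comp_dist_row1 (u v : R) : v != 0 ->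
  comp_dist (\row_(_ < 1) u) (\row_(_ < 1) v) = (`|u - v| / `|v|)%:E.
Proof.
move=> v0; rewrite /comp_dist big_ord_recl big_ord0 !mxE /comp_quot v0 /= normrM normfV.
by apply/max_idPl; rewrite lee_fin divr_ge0.
Qed.

Lemma comp_dist_row1_0 (u : R) :
  comp_dist (\row_(_ < 1) u) (\row_(_ < 1) 0) = if u == 0 then 0%E else +oo%E.
Proof.
rewrite /comp_dist big_ord_recl big_ord0 !mxE /comp_quot eqxx /= subr0.
case: eqVneq => _ /=; last by apply/max_idPl; exact: leey.
by rewrite normr0 maxxx.
Qed.

(** A finite componentwise distance forces zero entries to stay zero, so such
    perturbations are exactly the multiplicative ones. *)
Lemma comp_ball_relative n (A X : 'M[R]_n) (r : R) :
  0 <= r -> (comp_dist (mxvec X) (mxvec A) <= r%:E)%E ->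
  exists2 E : 'M[R]_n, (forall i j, `|E i j| <= r) &
    X = \matrix_(i, j) (A i j * (1 + E i j)).
Proof.
move=> r0 /(comp_dist_mxvec _ _ r0) h.
exists (\matrix_(i, j) ((X i j - A i j) / A i j)) => [i j|].
  rewrite mxE normrM normfV; have [->|a0] := eqVneq (A i j) 0.
    by rewrite normr0 invr0 mulr0.
  by rewrite ler_pdivrMr ?normr_gt0.
apply/matrixP => i j; rewrite !mxE; have [a0|a0] := eqVneq (A i j) 0.
  have := h i j; rewrite a0 normr0 mulr0 subr0 normr_le0 mul0r.
  by move/eqP.
by rewrite mulrDr mulr1 mulrCA divff // mulr1 addrC subrK.
Qed.

Lemma det_cond_ge0 n (A : 'M[R]_n) : 0 <= det_cond A.
Proof. by rewrite divr_ge0 // sumr_ge0 // => i _; rewrite sumr_ge0. Qed.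

(** Each row contributes at least 1, since its terms add up to det A. *)
Lemma det_cond_ge n (A : 'M[R]_n) : \det A != 0 -> n%:R <= det_cond A.
Proof.
move=> d0; rewrite ler_pdivlMr ?normr_gt0 // mulr_natl.
rewrite -[X in _ *+ X](card_ord n) -sumr_const; apply: ler_sum => i _.
by rewrite -(sum_laplace_term A i) ler_norm_sum.
Qed.

(** Both inequalities follow from the linearization, whose error is quadratic
    in the size of the perturbation. *)
Lemma cond_det_regular n (A : 'M[R]_n) : (0 < n)%N -> \det A != 0 ->
  cond_det A = (det_cond A)%:E.
Proof.
move=> n0 d0; have dgt0 : 0 < `|\det A| by rewrite normr_gt0.
rewrite /cond_det /comp_cond; set f := fun delta : R => ereal_sup _.
have [K K0 HK] := det_relative_linear_error A.
set G := \sum_i \sum_j `|laplace_term A i j|.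
have Ggt0 : 0 < G.
  rewrite /G; have := det_cond_ge d0.
  rewrite ler_pdivlMr //; apply: lt_le_trans; by rewrite mulr_gt0 ?ltr0n.
have fub delta : 0 < delta <= 1 ->
    (f delta <= (det_cond A + K / `|\det A| * delta)%:E)%E.
  move=> /andP[dlt0 dl1]; apply: ge_ereal_sup => _ [->|[x [[bx _] /= xa] <-]].
    by rewrite lee_fin addr_ge0 ?det_cond_ge0 // !mulr_ge0 ?invr_ge0 // ltW.
  have [r /andP[r0 rd] Er] := comp_dist_fin bx xa.
  rewrite Er mxvecK comp_dist_row1 // inver gt_eqF // -EFinM lee_fin.
  have [|E hE ->] := @comp_ball_relative _ A (vec_mx x) r (ltW r0).
    by rewrite vec_mxK Er.
  have {HK} := HK E r; rewrite (ltW r0) (le_trans rd dl1) => /(_ erefl hE).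
  set X := \matrix_(i, j) _; set t := \sum_i _ => h.
  have ht : `|t| <= r * G.
    rewrite /t /G (le_trans (ler_norm_sum _ _ _)) // big_distrr /=.
    apply: ler_sum => i _; rewrite (le_trans (ler_norm_sum _ _ _)) // big_distrr /=.
    by apply: ler_sum => j _; rewrite normrM ler_wpM2r.
  have h2 : `|\det X - \det A| <= r * G + K * r ^+ 2.
    by rewrite -[X in `|X|](subrK t) addrC (le_trans (ler_normD _ _)) // lerD.
  rewrite ler_pdivrMr // ler_pdivrMr // (le_trans h2) //.
  have -> : (det_cond A + K / `|\det A| * delta) * r * `|\det A| =
    r * G + K * r * delta by rewrite /det_cond -/G; field; rewrite gt_eqF.
  by rewrite lerD2l expr2 mulrA ler_wpM2l // mulr_ge0 // ltW.
(* Perturbing every entry by the same small factor s, with the signs of the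
   terms, gives a quotient at least det_cond A - eps. *)
have flb delta : 0 < delta -> ((det_cond A)%:E <= f delta)%E.
  move=> dlt0; apply/lee_addgt0Pr => eps eps0.
  pose s := Num.min 1 (Num.min delta (eps * `|\det A| / (K + 1))).
  have K1 : 0 < K + 1 by lra.
  have s0 : 0 < s by rewrite !lt_min ltr01 dlt0 !mulr_gt0 // invr_gt0.
  have s1 : s <= 1 by rewrite ge_min lexx.
  have sd : s <= delta by rewrite !ge_min lexx orbT.
  have se : s * K <= eps * `|\det A|.
    have : s <= eps * `|\det A| / (K + 1) by rewrite !ge_min lexx !orbT.
    by rewrite ler_pdivlMr // => h; rewrite (le_trans _ h) // ler_pM2l //; lra.
  pose E : 'M[R]_n := \matrix_(i, j) (if 0 <= laplace_term A i j then s else - s).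
  pose X : 'M[R]_n := \matrix_(i, j) (A i j * (1 + E i j)).
  have hE i j : `|E i j| = s.
    by rewrite mxE; case: ifP => _; rewrite ?normrN ger0_norm // ltW.
  have hE' i j : `|E i j| <= s by rewrite hE.
  have {HK} := HK E s; rewrite (ltW s0) s1 => /(_ erefl hE'); rewrite -/X.
  have -> : \sum_i \sum_j E i j * laplace_term A i j = s * G.
    rewrite /G big_distrr /=; apply: eq_bigr => i _.
    rewrite big_distrr /=; apply: eq_bigr => j _; rewrite mxE.
    case: ifPn => [/ger0_norm -> //|]; rewrite -ltNge => /ltr0_norm ->.
    by rewrite mulNr mulrN.
  move=> h.
  have hX i j : `|X i j - A i j| = s * `|A i j|.
    by rewrite mxE mulrDr mulr1 addrC addKr normrM hE mulrC.
  have dX : comp_dist (mxvec X) (mxvec A) = s%:E.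
    apply/eqP; rewrite eq_le; apply/andP; split.
      by apply/comp_dist_mxvec; [exact: ltW|move=> i j; rewrite hX].
    have [[i j] Aij0] : exists ij : 'I_n * 'I_n, A ij.1 ij.2 != 0.
      apply: contrapT => /forallNP A0; move: d0; rewrite (_ : A = 0).
        by case: {+}n n0 => // m _; rewrite det0 eqxx.
      by apply/matrixP => i j; rewrite mxE; have /negP/negPn/eqP := A0 (i, j).
    rewrite leNgt; apply/negP => /[dup] lts.
    have := comp_dist_ge0 (mxvec X) (mxvec A).
    case Er : (comp_dist _ _) lts => [r| |] //= _.
    rewrite lee_fin lte_fin => r0 rs.
    have := comp_dist_mxvec X A r0; rewrite Er lexx => -[/(_ erefl) /(_ i j)].
    by rewrite hX ler_pM2r ?normr_gt0 // leNgt rs.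
  have Gs : (s * G - K * s ^+ 2) <= `|\det X - \det A|.
    have h1 := ler_norm (s * G - (\det X - \det A)); rewrite distrC in h1.
    have h2 := ler_norm (\det X - \det A); lra.
  apply: (@le_trans _ _ ((`|\det X - \det A| / `|\det A| / s)%:E + eps%:E)%E).
    rewrite -EFinD lee_fin -lerBlDr !ler_pdivlMr //.
    apply: le_trans Gs.
    have -> : (det_cond A - eps) * s * `|\det A| = s * G - s * (eps * `|\det A|).
      by rewrite /det_cond -/G; field; rewrite gt_eqF.
    rewrite lerD2l lerN2 expr2 mulrCA ler_pM2l // mulrC //.
  rewrite leeD2r //; apply: ereal_sup_ubound; right; exists (mxvec X).
    split; [split => //|].
      by rewrite /comp_ball /= dX lee_fin.
    by move=> XA; move: dX; rewrite XA => /eqP; rewrite eq_le => /andP[_];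
      apply/negP; rewrite -ltNge; apply: le_lt_trans (_ : 0 < _)%E;
      [apply/comp_dist_mxvec => // i j; rewrite subrr normr0 mul0r|rewrite lte_fin].
  by rewrite !mxvecK comp_dist_row1 // dX inver gt_eqF.
apply/cvg_lim => //.
apply: (@squeeze_cvge _ _ _ _ (cst (det_cond A)%:E) _
  (fun delta => (det_cond A + K / `|\det A| * delta)%:E)).
- near=> delta; apply/andP; split; first by apply: flb.
  by apply: fub; apply/andP; split => //; near: delta; apply: nbhs_right_le.
- exact: cvg_cst.
- apply: cvg_EFin; first by near=> x.
  rewrite -[X in _ --> X]addr0; apply: cvgD; first exact: cvg_cst.
  rewrite -[X in _ --> X](mulr0 (K / `|\det A|)); apply: cvgM; first exact: cvg_cst.
  exact: cvg_at_right_filter.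
Unshelve. all: by end_near.
Qed.

(** The determinant along the segment is a nonzero polynomial in s, so it
    misses one of the values e, e / 2, e / 3, ... *)
Lemma det_segment_neq0 n (A B : 'M[R]_n) (e : R) : \det B != 0 -> 0 < e ->
  exists2 s, 0 < s <= e & \det (A + s *: (B - A)) != 0.
Proof.
move=> dB e0.
pose p : {poly R} := \det (map_mx polyC A + 'X *: map_mx polyC (B - A)).
have pE s : p.[s] = \det (A + s *: (B - A)).
  rewrite /p -horner_evalE -det_map_mx; congr (\det _).
  by apply/matrixP => i j; rewrite !mxE /= /horner_eval !hornerE.
have p0 : p != 0.
  apply/eqP => p0; move: dB; rewrite -[B in \det B](subrK A) addrC.
  by rewrite -[B - A]scale1r -pE p0 horner0 eqxx.
pose c k : R := e / k.+1%:R.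
have injc : injective c.
  move=> i j /(mulfI (lt0r_neq0 e0)) /invr_inj /eqP.
  by rewrite eqr_nat eqSS => /eqP.
have : ~~ all (root p) (map c (iota 0 (size p))).
  apply/negP => ap; have := max_poly_roots p0 ap.
  rewrite map_inj_uniq // iota_uniq => /(_ erefl).
  by rewrite size_map size_iota ltnn.
rewrite -has_predC => /hasP[_ /mapP[k _ ->]] /= rk.
exists (c k); last by rewrite -pE.
rewrite divr_gt0 ?ltr0n //= ler_pdivrMr ?ltr0n // ler_peMr ?ler1n //.
exact: ltW.
Qed.

(** Nonzero exactly when some matrix supported on the nonzero entries of A is
    regular. Unlike that condition, it is visibly a measurable function of
    A. *)
Definition abs_permanent n (A : 'M[R]_n) : R :=
  \sum_(s : 'S_n) \prod_k `|A k (s k)|.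

Lemma abs_permanent_neq0P n (A : 'M[R]_n) :
  reflect (exists2 B : 'M[R]_n, (forall i j, A i j = 0 -> B i j = 0) & \det B != 0)
    (abs_permanent A != 0).
Proof.
apply: (iffP idP) => [|[B AB]].
  rewrite psumr_neq0 => [/hasP[s _ /=]|s _]; last exact: prodr_ge0.
  rewrite lt0r => /andP[/prodf_neq0 As _].
  exists (perm_mx s) => [i j Aij|]; last by rewrite det_perm signr_eq0.
  rewrite !mxE; case: eqP => //= sij; have := As i isT.
  by rewrite sij Aij normr0 eqxx.
apply: contraNneq => /eqP; rewrite psumr_eq0 => [/allP As|s _]; last exact: prodr_ge0.
rewrite /determinant big1 // => s _; have := As s (mem_index_enum s).
move=> /prodf_eq0[k _]; rewrite normr_eq0 => /eqP /AB Bk.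
by rewrite (bigD1 k) //= Bk mul0r mulr0.
Qed.

(** A relative perturbation of a zero determinant is infinite unless the
    determinant stays zero. It can be made nonzero near A, within the pattern of
    nonzero entries of A, iff it does not vanish identically on that pattern. *)
Lemma cond_det_singular n (A : 'M[R]_n) : \det A = 0 ->
  cond_det A = if abs_permanent A != 0 then +oo%E else 0%E.
Proof.
move=> d0; rewrite /cond_det /comp_cond; set f := fun delta : R => ereal_sup _.
case: abs_permanent_neq0P => [[B AB dB]|nreg].
  have fE delta : 0 < delta -> f delta = +oo%E.
    move=> dlt0.
    pose M := \sum_i \sum_j `|B i j - A i j| / `|A i j|.
    have M0 : 0 <= M.
      apply: sumr_ge0 => i _; apply: sumr_ge0 => j _; exact: divr_ge0.
    have hM i j : `|B i j - A i j| <= M * `|A i j|.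
      have [Aij|Aij] := eqVneq (A i j) 0; first by rewrite AB // Aij subr0 normr0 mulr0.
      rewrite -ler_pdivrMr ?normr_gt0 // /M (bigD1 i) //= (bigD1 j) //= -addrA lerDl.
      apply: addr_ge0; apply: sumr_ge0 => k _; first by rewrite divr_ge0.
      by apply: sumr_ge0 => l _; rewrite divr_ge0.
    have e0 : 0 < delta / (M + 1) by rewrite divr_gt0 // ltr_wpDl.
    have [s /andP[s0 se] ds] := det_segment_neq0 A dB e0.
    have := se; rewrite ler_pdivlMr ?ltr_wpDl // => {}se.
    pose X := A + s *: (B - A).
    have bX : comp_ball (mxvec A) delta (mxvec X).
      apply/comp_dist_mxvec => [|i j]; first exact: ltW.
      rewrite !mxE addrAC subrr add0r normrM ger0_norm ?(ltW s0) //.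
      rewrite (le_trans (ler_wpM2l (ltW s0) (hM i j))) // mulrA ler_wpM2r //.
      by rewrite (le_trans _ se) // ler_pM2l // lerDl.
    have XA : mxvec X <> mxvec A.
      by move=> /(can_inj mxvecK) E; move: ds; rewrite -/X E d0 eqxx.
    apply/eqP; rewrite -leye_eq; apply: ereal_sup_ubound; right.
    exists (mxvec X) => //.
    have [r /andP[r0 _] ->] := comp_dist_fin bX XA.
    rewrite !mxvecK d0 comp_dist_row1_0 (negPf ds) inver gt_eqF //.
    by rewrite mulyr gtr0_sg ?mul1e // invr_gt0.
  apply/cvg_lim => //; apply: (@cvg_trans _ (cst +oo%E @ 0^'+)); last exact: cvg_cst.
  apply: near_eq_cvg; near=> delta; rewrite fE //; near: delta; exact: nbhs_right_gt.
have fE delta : 0 < delta -> f delta = 0%E.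
  move=> dlt0; apply/eqP; rewrite eq_le; apply/andP; split; last first.
    by apply: ereal_sup_ubound; left.
  apply: ge_ereal_sup => _ [->//|[x [[bx _] /= xa] <-]].
  rewrite mxvecK d0 comp_dist_row1_0; case: eqP => [_|/eqP dx]; first by rewrite mul0e.
  exfalso; apply: nreg; exists (vec_mx x) => // i j Aij.
  move: bx; rewrite -[x]vec_mxK => /(comp_dist_mxvec _ _ (ltW dlt0)) /(_ i j).
  by rewrite Aij normr0 mulr0 subr0 normr_le0 vec_mxK => /eqP.
apply/cvg_lim => //; apply: (@cvg_trans _ (cst 0%E @ 0^'+)); last exact: cvg_cst.
apply: near_eq_cvg; near=> delta; rewrite fE //; near: delta; exact: nbhs_right_gt.
Unshelve. all: by end_near.
Qed.

End cond_det_formula.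

(** * Measurability *)

Section measurability.
Context d (T : measurableType d) {R : realType}.

Lemma measurable_set_ltr (f g : T -> R) : measurable_fun setT f ->
  measurable_fun setT g -> measurable [set x | f x < g x].
Proof.
move=> mf mg; rewrite -[X in measurable X]setTI.
have := @measurable_fun_ltr _ T R setT f g mf mg.
by move=> /(_ measurableT [set true] I).
Qed.

Lemma measurable_sumr (I : Type) (s : seq I) (p : pred I) (f : I -> T -> R) :
  (forall i, p i -> measurable_fun setT (f i)) ->
  measurable_fun setT (fun w => \sum_(i <- s | p i) f i w).
Proof.
move=> mf; elim: s => [|i s IH].
  by under eq_fun do rewrite big_nil; exact: measurable_cst.
under eq_fun do rewrite big_cons; case pi: (p i) => //.
by apply: measurable_funD => //; exact: mf.
Qed.

Lemma measurable_prodr (I : Type) (s : seq I) (p : pred I) (f : I -> T -> R) :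
  (forall i, p i -> measurable_fun setT (f i)) ->
  measurable_fun setT (fun w => \prod_(i <- s | p i) f i w).
Proof.
move=> mf; elim: s => [|i s IH].
  by under eq_fun do rewrite big_nil; exact: measurable_cst.
under eq_fun do rewrite big_cons; case pi: (p i) => //.
by apply: measurable_funM => //; exact: mf.
Qed.

Lemma measurable_det n (M : T -> 'M[R]_n) :
  (forall i j, measurable_fun setT (fun w => M w i j)) ->
  measurable_fun setT (fun w => \det (M w)).
Proof.
move=> mM; apply: measurable_sumr => s _; apply: measurable_funM => //.
by apply: measurable_prodr => i _.
Qed.

Lemma measurable_cofactor n (M : T -> 'M[R]_n) i j :
  (forall k l, k != i -> measurable_fun setT (fun w => M w k l)) ->
  measurable_fun setT (fun w => cofactor (M w) i j).
Proof.
move=> mM; apply: measurable_funM => //; apply: measurable_det => k l.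
under eq_fun do rewrite !mxE.
by apply: mM; rewrite eq_sym neq_lift.
Qed.

Lemma measurable_abs_permanent n (M : T -> 'M[R]_n) :
  (forall i j, measurable_fun setT (fun w => M w i j)) ->
  measurable_fun setT (fun w => abs_permanent (M w)).
Proof.
move=> mM; apply: measurable_sumr => s _; apply: measurable_prodr => i _.
exact: measurableT_comp.
Qed.

Lemma measurable_laplace_term n (M : T -> 'M[R]_n) i j :
  (forall i j, measurable_fun setT (fun w => M w i j)) ->
  measurable_fun setT (fun w => laplace_term (M w) i j).
Proof.
by move=> mM; apply: measurable_funM => //; apply: measurable_cofactor => k l _.
Qed.

Lemma measurable_det_cond n (M : T -> 'M[R]_n) :
  (forall i j, measurable_fun setT (fun w => M w i j)) ->
  measurable_fun setT (fun w => det_cond (M w)).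
Proof.
move=> mM; apply: measurable_funM.
  apply: measurable_sumr => i _; apply: measurable_sumr => j _.
  by apply: measurableT_comp => //; exact: measurable_laplace_term.
under eq_fun => w do rewrite -powR_inv1 //.
apply: (measurableT_comp (measurable_powR (- 1))).
by apply: measurableT_comp => //; exact: measurable_det.
Qed.

Lemma measurable_set_eqr (f g : T -> R) : measurable_fun setT f ->
  measurable_fun setT g -> measurable [set x | f x == g x].
Proof.
move=> mf mg; rewrite -[X in measurable X]setTI.
by have /(_ measurableT [set true] I) := @measurable_fun_eqr _ T R setT f g mf mg.
Qed.

(** The tail needs the case where f is the identity, the expectation the case
    where f is a logarithm. *)
Lemma measurable_comp_cond_det n (M : T -> 'M[R]_n) (f : \bar R -> \bar R) :
  (0 < n)%N ->
  (forall i j, measurable_fun setT (fun w => M w i j)) ->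
  measurable_fun setT (fun r : R => f r%:E) ->
  measurable_fun setT (fun w => f (cond_det (M w))).
Proof.
move=> n0 mM mf.
have -> : (fun w => f (cond_det (M w))) =
    fun w => if \det (M w) == 0 then
      (if abs_permanent (M w) == 0 then f 0%E else f +oo%E)
      else f (det_cond (M w))%:E.
  apply/funext => w; case: eqVneq => [d0|d0]; last by rewrite cond_det_regular.
  by rewrite cond_det_singular //; case: eqVneq.
apply: measurable_fun_ifT.
- by apply: measurable_fun_eqr => //; exact: measurable_det.
- apply: measurable_fun_ifT => //.
  by apply: measurable_fun_eqr => //; exact: measurable_abs_permanent.
- exact: (measurableT_comp mf (measurable_det_cond mM)).
Qed.

Lemma measurable_set_has (I : eqType) (s : seq I) (Q : I -> T -> bool) :
  (forall i, i \in s -> measurable [set w | Q i w]) ->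
  measurable [set w | has (Q^~ w) s].
Proof.
elim: s => [|i s IH] mQ.
  by rewrite (_ : mkset _ = set0) //; apply/seteqP; split.
rewrite (_ : mkset _ = [set w | Q i w] `|` [set w | has (Q^~ w) s]).
  apply: measurableU; first by apply: mQ; rewrite mem_head.
  by apply: IH => j js; apply: mQ; rewrite in_cons js orbT.
by apply/seteqP; split => w /= => [/orP|h]; last exact/orP.
Qed.

Lemma measure_has_le (mu : {measure set T -> \bar R}) (I : eqType) (s : seq I)
    (Q : I -> T -> bool) :
  (forall i, i \in s -> measurable [set w | Q i w]) ->
  (mu [set w | has (Q^~ w) s] <= \sum_(i <- s) mu [set w | Q i w])%E.
Proof.
elim: s => [|i s IH] mQ.
  rewrite big_nil (_ : mkset _ = set0) ?measure0 //; by apply/seteqP; split.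
rewrite (_ : mkset _ = [set w | Q i w] `|` [set w | has (Q^~ w) s]); last first.
  by apply/seteqP; split => w /= => [/orP|h]; last exact/orP.
have mQs j : j \in s -> measurable [set w | Q j w].
  by move=> js; apply: mQ; rewrite in_cons js orbT.
rewrite big_cons; apply: le_trans (measureU2 _ _ _) _.
- by apply: mQ; rewrite mem_head.
- exact: measurable_set_has.
- by rewrite leeD2l // IH.
Qed.

End measurability.

(** * One variable independent of all the others *)

Section one_against_others.
Context d (T : measurableType d) (R : realType) (P : probability T R).
Variables (I : finType) (K : {set I}) (X : I -> {RV P >-> R}).

Definition cylinder (J : {set I}) (B : I -> set R) : set T :=
  \bigcap_(i in [set` J]) X i @^-1` B i.

Definition cylinders (e : I) : set (set T) :=
  [set D | exists2 B : I -> set R,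
     (forall i, measurable (B i)) & D = cylinder (K :\ e) B].

(** The underlying type is T, equipped with the sigma-algebra generated by the
    variables other than X e: a function measurable on it depends only on
    these variables. *)
Definition others (e : I) := g_sigma_algebraType (cylinders e).

Lemma measurable_cylinder J B : (forall i, measurable (B i)) ->
  measurable (cylinder J B).
Proof.
move=> mB; apply: fin_bigcap_measurable => // i _.
by rewrite -[X in measurable X]setTI; exact: measurable_funPT.
Qed.

Lemma measurable_others e (A : set T) :
  (cylinders e).-sigma.-measurable A -> measurable A.
Proof.
move: A; apply: smallest_sub; first exact: sigma_algebra_measurable.
by move=> _ [B mB ->]; exact: measurable_cylinder.
Qed.

Lemma setI_cylinders e : setI_closed (cylinders e).
Proof.
move=> _ _ [B mB ->] [C mC ->]; exists (fun i => B i `&` C i).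
  by move=> i; exact: measurableI.
by rewrite /cylinder -bigcapI; apply: eq_bigcapr => i _; rewrite preimage_setI.
Qed.

Lemma setT_cylinders e : cylinders e setT.
Proof.
exists (fun=> setT); first by [].
by apply/esym; rewrite -subTset => w _ i _.
Qed.

Lemma measurable_other e i : i \in K -> i != e ->
  measurable_fun setT (X i : others e -> R).
Proof.
move=> iK ie _ B mB; rewrite setTI; apply: sub_sigma_algebra.
exists (fun j => if j == i then B else setT) => [j|]; first by case: ifP.
apply/seteqP; split => w /=.
  by move=> Bw j _ /=; case: eqP => // ->.
by move=> /(_ i) /=; rewrite eqxx !inE ie iK; apply.
Qed.

Hypothesis indX : mutually_independent K X.

(** Both sides are finite measures in D that agree on the pi-system of
    cylinders, by independence. *)
Lemma independent_others e (A : set R) (D : set T) : e \in K -> measurable A ->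
  (cylinders e).-sigma.-measurable D ->
  (P (D `&` X e @^-1` A) = P (X e @^-1` A) * P D)%E.
Proof.
move=> eK mA mD.
have mXA : measurable (X e @^-1` A).
  by rewrite -[X in measurable X]setTI; exact: measurable_funPT.
pose r : {nonneg R} := NngNum (fine_ge0 (measure_ge0 P (X e @^-1` A))).
have rE : r%:num%:E = P (X e @^-1` A) by rewrite /= fineK // fin_num_measure.
have scaleE D' : mscale r P D' = (P (X e @^-1` A) * P D')%E by rewrite -rE.
suff : mrestr P mXA D = mscale r P D.
  by move=> h; exact: (etrans h (scaleE D)).
apply: (g_sigma_algebra_measure_unique (cylinders e) _ (fun=> setT)) => //.
- by move=> _ [B mB ->]; exact: measurable_cylinder.
- by move=> _; exact: setT_cylinders.
- by rewrite bigcup_const //; exists 0%N.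
- exact: setI_cylinders.
- move=> _ [B mB ->]; apply: etrans (esym (scaleE _)); rewrite /mrestr.
  pose B' i := if i == e then A else B i.
  have mB' i : measurable (B' i) by rewrite /B'; case: ifP.
  have BB' : cylinder (K :\ e) B `&` X e @^-1` A = cylinder K B'.
    apply/seteqP; split => w.
      move=> [Bw Aw] i iK; rewrite /= /B'; case: eqP => [->//|/eqP ie].
      by apply: Bw; rewrite /= !inE ie.
    move=> Bw; split => [i|].
      rewrite /= !inE => /andP[ie iK]; have := Bw i iK.
      by rewrite /= /B' (negPf ie).
    by have := Bw e eK; rewrite /= /B' eqxx.
  apply: (etrans (congr1 P BB')).
  rewrite indX // indX ?subsetDl // (bigD1 e) //= /B' eqxx; congr (_ * _)%E.
  apply: eq_big => [i|i /andP[_ /negPf ->] //]; by rewrite !inE andbC.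
- by move=> k; rewrite ltey_eq /mrestr fin_num_measure //; exact: measurableI.
Qed.

Section with_entry.
Variable e : I.

Definition to_others : T -> others e := id.

Lemma measurable_to_others : measurable_fun setT to_others.
Proof. by move=> _ A mA; rewrite setTI; exact: measurable_others mA. Qed.

HB.instance Definition _ :=
  isMeasurableFun.Build _ _ _ _ to_others measurable_to_others.

Definition split_entry (w : T) : R * others e := (X e w, to_others w).

Lemma measurable_split_entry : measurable_fun setT split_entry.
Proof. by apply: measurable_fun_pair => //; exact: measurable_to_others. Qed.

HB.instance Definition _ :=
  isMeasurableFun.Build _ _ _ _ split_entry measurable_split_entry.

(** Bounding a probability by freezing all variables but one: the joint law of
    X e and of the other variables is a product, so the probability of E is the
    average of the probabilities of its sections. *)
Lemma probability_sections_le (E : set (R * others e)) (c : \bar R) : e \in K ->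
  measurable E ->
  (forall w, distribution P (X e) [set x | E (x, w)] <= c)%E ->
  (P [set w | E (X e w, w)] <= c)%E.
Proof.
move=> eK mE Ec.
pose m1 := distribution P (X e).
pose m2 := distribution P (to_others : {mfun T >-> others e}).
pose m' := distribution P (split_entry : {mfun T >-> (R * others e)%type}).
have m'E A B : measurable A -> measurable B -> m' (A `*` B) = (m1 A * m2 B)%E.
  move=> mA mB; rewrite /m1 /m2 /distribution /pushforward /=.
  rewrite -independent_others // setIC; congr (P _).
apply: (@le_trans _ _ ((m1 \x m2)%E E)).
  by rewrite (product_measure_unique m'E mE); exact: lexx.
have -> : (m1 \x m2)%E E = (m1 \x^ m2)%E E.
  apply: product_measure_unique => // A B mA mB; exact: product_measure2E.
have c0 : (0 <= c)%E by apply: le_trans (Ec point); exact: measure_ge0.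
have EcE y : (m1 (ysection E y) <= c)%E.
  apply: le_trans (Ec y); rewrite le_eqVlt; apply/orP; left; apply/eqP.
  by congr (m1 _); apply/seteqP; split => x; rewrite /ysection /= inE.
apply: (@le_trans _ _ (\int[m2]_y c)%E).
  have mf := @measurable_fun_ysection _ _ _ _ R m1 E mE.
  apply: ge0_le_integral.
  - exact: measurableT.
  - by move=> y _; exact: measure_ge0.
  - exact: mf.
  - by [].
  - by move=> y _; exact: EcE.
have mT : (m2 setT = 1)%E by exact: probability_setT.
have -> : (\int[m2]_y c = c * m2 setT)%E by exact: (integral_cst m2 measurableT c).
by rewrite mT mule1.
Qed.

End with_entry.

End one_against_others.

(** * Gaussian estimates *)

Section gauss.
Context {R : realType}.
Implicit Types m s x t : R.

(** sin x <= x at x = pi / 6, where sin x = 1 / 2. *)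
Lemma pi_ge3 : 3 <= pi :> R.
Proof.
pose x : R := pi / 6.
have x0 : 0 < x by rewrite divr_gt0 // pi_gt0.
have sx : sin x <= x.
  have [|c _] := @MVT R sin cos 0 x x0 (fun y _ => is_derive_sin y).
    by apply: continuous_subspaceT => y; exact: continuous_sin.
  by rewrite sin0 !subr0 => ->; rewrite ler_piMl ?cos_le1 // ltW.
have s0 : 0 <= sin x.
  by apply: sin_ge0_pi; rewrite ltW //=; have := pi_gt0 R; rewrite /x; lra.
have := sin_pihalf R; rewrite (_ : pi / 2 = (x + x) + x); last by rewrite /x; field.
rewrite sinD sinD cosD => h.
have c2 := cos2Dsin2 x.
(* the triple angle formula, 1 = 3 sin x - 4 (sin x)^3, factored *)
have : (sin x + 1) * (2 * sin x - 1) ^+ 2 = 0 by nra.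
move/eqP; rewrite mulf_eq0 sqrf_eq0 => /orP[] /eqP h2; last by rewrite /x in sx; lra.
lra.
Qed.

Lemma normal_peak_scale s : 0 < s -> 2 * normal_peak s = Num.sqrt (2 / pi) / s.
Proof.
move=> s0; rewrite /normal_peak; move: (@pi R) (pi_gt0 R) => p p0.
have -> : s ^+ 2 * p *+ 2 = s ^+ 2 * (2 * p) by rewrite -mulr_natl mulrCA.
have -> : 2 / p = 2 ^+ 2 * (2 * p)^-1 by field; rewrite gt_eqF.
rewrite (sqrtrM (2 * p)) ?(sqrtrM (2 * p)^-1) ?sqr_ge0 // !sqrtr_sqr.
rewrite gtr0_norm // ger0_norm // sqrtrV ?mulr_ge0 ?ltW //.
by rewrite invfM mulrCA mulrC.
Qed.

(** With z = |x - m| / s one has |x| <= 1 + s * z, the exponential factor is at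
    most 1 / (1 + z ^ 2 / 2), and z / (1 + z ^ 2 / 2) is at most
    1 / sqrt 2 < 3 / 4. *)
Lemma norm_mul_normal_pdf_le m s x : `|m| <= 1 -> 0 < s ->
  `|x| * normal_pdf m s x <= (1 + 3 / 4 * s) * normal_peak s.
Proof.
move=> m1 s0; have sn0 : s != 0 by rewrite gt_eqF.
rewrite normal_pdfE // mulrCA mulrC ler_wpM2r ?normal_peak_ge0 // /normal_fun.
pose z := `|x - m| / s.
have z0 : 0 <= z by rewrite divr_ge0 // ltW.
have -> : - (x - m) ^+ 2 / (s ^+ 2 *+ 2) = - (z ^+ 2 / 2).
  by rewrite /z expr_div_n real_normK ?num_real // -mulr_natr; field.
have xz : `|x| <= 1 + s * z.
  have -> : s * z = `|x - m| by rewrite /z mulrC divfK.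
  by have := ler_normD (x - m) m; rewrite subrK; lra.
rewrite expRN ler_pdivrMr ?expR_gt0 //.
have := expR_ge1Dx (z ^+ 2 / 2); set e := expR _ => he.
apply: (le_trans xz); apply: (@le_trans _ _ ((1 + 3 / 4 * s) * (1 + z ^+ 2 / 2))).
  have : z <= 3 / 4 * (1 + z ^+ 2 / 2) by have := sqr_ge0 (z - 4 / 3); lra.
  by have := sqr_ge0 z; nra.
by rewrite ler_wpM2l // addr_ge0 // mulr_ge0 // ltW.
Qed.

(** On the interval the density is at most the bound for |x| times the density,
    divided by L. *)
Lemma normal_prob_itv_le m s L U (i : interval R) : `|m| <= 1 -> 0 < s ->
  0 < L <= U -> i = `[L, U] \/ i = `[- U, - L] ->
  (normal_prob m s [set` i] <=
     ((1 + 3 / 4 * s) * normal_peak s * (U - L) / L)%:E)%E.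
Proof.
move=> m1 s0 /andP[L0 LU] Hi; set M := (1 + _) * _.
have mi : measurable [set` i] by exact: measurable_itv.
apply: (@le_trans _ _ (\int[lebesgue_measure]_(x in [set` i]) (M / L)%:E)%E).
  apply: ge0_le_integral => //.
  - by move=> x _; rewrite lee_fin normal_pdf_ge0.
  - by apply/measurable_EFinP; apply: measurable_funTS; exact: measurable_normal_pdf.
  - move=> x ix; rewrite lee_fin ler_pdivlMr // mulrC.
    apply: le_trans (norm_mul_normal_pdf_le x m1 s0).
    rewrite ler_wpM2r ?normal_pdf_ge0 //.
    by case: Hi ix => -> /=; rewrite in_itv /= => /andP[? ?];
      [rewrite ger0_norm|rewrite ler0_norm]; lra.
rewrite integral_cst //= (_ : lebesgue_measure _ = (U - L)%:E).
  by rewrite -EFinM lee_fin mulrAC.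
case: Hi => ->; rewrite lebesgue_measure_itv /= lte_fin.
  by case: ltgtP LU => //= -> _; rewrite subrr.
rewrite ltrN2; case: ltgtP LU => //= [_|->] _; rewrite ?subrr //.
by rewrite opprK addrC.
Qed.

Lemma ratio_itv t c x : 1 < t -> 0 < c -> t * `|x - c| < `|x| ->
  c * t / (t + 1) <= x <= c * t / (t - 1).
Proof.
move=> t1 c0 h; rewrite ler_pdivrMr ?ler_pdivlMr; try lra.
have t0 : 0 <= t by lra.
have h1 := le_lt_trans (ler_wpM2l t0 (ler_norm (x - c))) h.
have h2 : t * (c - x) < `|x|.
  by apply: le_lt_trans h; rewrite distrC ler_wpM2l // ler_norm.
have x0 : 0 < x.
  rewrite ltNge; apply/negP => x0; move: h2; rewrite ler0_norm //.
  by have := mulr_gt0 (lt_trans ltr01 t1) c0; nra.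
by move: h1 h2; rewrite gtr0_norm // => h1 h2; apply/andP; split; lra.
Qed.

(** The interval has length 2 L / (t - 1), so the factor 1 / L in the bound for
    the density cancels: the estimate is uniform in a and b. *)
Lemma normal_prob_ratio_le m s t (a b : R) : `|m| <= 1 -> 0 < s -> 1 < t ->
  (normal_prob m s [set x : R | t * `|x * a + b| < `|x * a|]%R <=
   ((1 + 3 / 4 * s) / s * Num.sqrt (2 / pi) / (t - 1))%:E)%E.
Proof.
move=> m1 s0 t1; set M := (_ / (t - 1)).
have M0 : 0 <= M.
  by rewrite /M !mulr_ge0 ?invr_ge0 ?sqrtr_ge0 // ?subr_ge0; lra.
have mE : measurable [set x | t * `|x * a + b| < `|x * a|].
  apply: measurable_set_ltr.
    apply: measurable_funM => //; apply: measurableT_comp => //.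
    by apply: measurable_funD => //; apply: measurable_funM.
  by apply: measurableT_comp => //; apply: measurable_funM.
have [a0|a0] := eqVneq a 0.
  rewrite (_ : mkset _ = set0) ?measure0 ?lee_fin //.
  apply/seteqP; split => // x /=; rewrite a0 mulr0 normr0 add0r.
  by rewrite ltNge mulr_ge0 //; lra.
pose c := - b / a.
have E x : (t * `|x * a + b| < `|x * a|) = (t * `|x - c| < `|x|).
  have -> : x * a + b = (x - c) * a by rewrite /c mulrBl divfK // opprK.
  by rewrite !normrM mulrA ltr_pM2r // normr_gt0.
have [c0|c0] := eqVneq c 0.
  rewrite (_ : mkset _ = set0) ?measure0 ?lee_fin //.
  apply/seteqP; split => // x /=; rewrite E c0 subr0.
  by rewrite ltNge ler_peMl // ltW.
pose L := `|c| * t / (t + 1); pose U := `|c| * t / (t - 1).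
have cgt0 : 0 < `|c| by rewrite normr_gt0.
have L0 : 0 < L by rewrite divr_gt0 ?mulr_gt0 //; lra.
have LU : L <= U.
  rewrite /L /U ler_wpM2l //; first by rewrite mulr_ge0 //; lra.
  by rewrite lef_pV2 ?posrE; lra.
have Lt : L * (t + 1) = `|c| * t by rewrite /L divfK // gt_eqF //; lra.
have Ut : U * (t - 1) = `|c| * t by rewrite /U divfK // gt_eqF //; lra.
pose i : interval R := if 0 < c then `[L, U] else `[- U, - L].
apply: (@le_trans _ _ (normal_prob m s [set` i])).
  apply: le_measure; rewrite ?inE //.
  move=> x /=; rewrite E /i; case: (ltP 0 c) => cs.
    by move=> /(ratio_itv t1 cs); rewrite in_itv /= /L /U gtr0_norm.
  have {}cs : 0 < - c by rewrite oppr_gt0 lt_neqAle c0.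
  rewrite -normrN opprB addrC -[c in X in t * X]opprK -[in ltRHS]normrN.
  move=> /(ratio_itv t1 cs); rewrite in_itv /= /L /U -normrN gtr0_norm //.
  by rewrite lerNl lerNr andbC.
apply: (le_trans (@normal_prob_itv_le m s L U i m1 s0 _ _)).
- by rewrite L0.
- by rewrite /i; case: ifP => _; [left|right].
rewrite lee_fin /M -[_ / s * _]mulrA [s^-1 * _]mulrC -normal_peak_scale //.
have -> : (U - L) = L * (2 / (t - 1)) by rewrite /U /L; field; apply/andP; split; lra.
rewrite le_eqVlt; apply/orP; left; apply/eqP; field.
by apply/andP; split; lra.
Qed.

End gauss.

(** * Random sparse determinants *)

Section cofactor_expansion.
Context {R : realType} {n : nat}.
Implicit Types M N : 'M[R]_n.

Definition laplace_rest M i j := \sum_(l | l != j) laplace_term M i l.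

Lemma det_affine M i j : \det M = M i j * cofactor M i j + laplace_rest M i j.
Proof. by rewrite -(sum_laplace_term M i) (bigD1 j). Qed.

Lemma eq_cofactor M N i j : (forall k l, k != i -> M k l = N k l) ->
  cofactor M i j = cofactor N i j.
Proof.
move=> MN; congr (_ * \det _); apply/matrixP => k l; rewrite !mxE.
by apply: MN; rewrite eq_sym neq_lift.
Qed.

Lemma eq_laplace_rest M N i j : (forall k l, (k, l) != (i, j) -> M k l = N k l) ->
  laplace_rest M i j = laplace_rest N i j.
Proof.
move=> MN; apply: eq_bigr => l lj; rewrite /laplace_term.
rewrite MN ?xpair_eqE ?(negPf lj) ?andbF //.
by rewrite (eq_cofactor (N := N)) // => k m ki; rewrite MN // xpair_eqE (negPf ki).
Qed.

End cofactor_expansion.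

Section one_fresh_entry.
Context d (T : measurableType d) (R : realType) (P : probability T R) (n : nat).
Variables (S : {set 'I_n * 'I_n}) (Abar : 'M[R]_n) (sigma : R).
Variable A : 'I_n -> 'I_n -> {RV P >-> R}.
Hypothesis sigma_gt0 : 0 < sigma.
Hypothesis Abar_le1 : `|Abar| <= 1.
Hypothesis gaussA : sparse_gaussian S Abar sigma A.

Let X (e : 'I_n * 'I_n) : {RV P >-> R} := A e.1 e.2.

Variables (e : 'I_n * 'I_n) (M : T -> 'M[R]_n).
Hypothesis eS : e \in S.
Hypothesis Me : forall w, M w e.1 e.2 = X e w.
Hypothesis mM : forall k l, (k, l) != e ->
  measurable_fun setT (fun w : others S X e => M w k l).

Let a (w : others S X e) := cofactor (M w) e.1 e.2.
Let b (w : others S X e) := laplace_rest (M w) e.1 e.2.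

Let ma : measurable_fun setT a.
Proof.
apply: measurable_cofactor => k l ki; apply: mM.
by apply: contraNneq ki => <-.
Qed.

Let mb : measurable_fun setT b.
Proof.
apply: measurable_sumr => l lj; apply: measurable_funM.
  by apply: mM; apply: contraNneq lj => <-.
by apply: measurable_cofactor => k m ki; apply: mM; apply: contraNneq ki => <-.
Qed.

Let detM w : \det (M w) = X e w * a w + b w.
Proof. by rewrite (det_affine _ e.1 e.2) Me. Qed.

Let ind : mutually_independent S X. Proof. by case: gaussA. Qed.

Let law B : measurable B ->
  distribution P (X e) B = normal_prob (Abar e.1 e.2) sigma B.
Proof. by move: B; case: gaussA => + _ _; apply; rewrite -surjective_pairing. Qed.

Let Abar_entry : `|Abar e.1 e.2| <= 1.
Proof.
apply: le_trans Abar_le1; have -> : `|Abar| = mx_norm Abar by [].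
by rewrite mx_normrE (bigD1 e) //= le_max lexx.
Qed.

Let mfst : measurable_fun setT (fun z : R * others S X e => z.1).
Proof. exact: measurable_fst. Qed.
Let msnda : measurable_fun setT (fun z : R * others S X e => a z.2).
Proof. exact: measurableT_comp ma measurable_snd. Qed.
Let msndb : measurable_fun setT (fun z : R * others S X e => b z.2).
Proof. exact: measurableT_comp mb measurable_snd. Qed.

(** Given the other entries, det M = x * a + b and the term is x * a. *)
Lemma laplace_ratio_tail_le t : 1 < t ->
  (P [set w | t * `|\det (M w)| < `|laplace_term (M w) e.1 e.2|]%R <=
   ((1 + 3 / 4 * sigma) / sigma * Num.sqrt (2 / pi) / (t - 1))%:E)%E.
Proof.
move=> t1.
have := @probability_sections_le _ T R P _ S X ind e
  [set z | t * `|z.1 * a z.2 + b z.2| < `|z.1 * a z.2|] _ eS.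
rewrite (_ : [set w | _] =
  [set w | t * `|\det (M w)| < `|laplace_term (M w) e.1 e.2|]); last first.
  by apply/seteqP; split => w /=; rewrite detM /laplace_term Me.
apply.
  apply: measurable_set_ltr.
    apply: measurable_funM => //; apply: measurableT_comp => //.
    by apply: measurable_funD => //; exact: measurable_funM.
  by apply: measurableT_comp => //; exact: measurable_funM.
move=> w /=; rewrite law; first exact: normal_prob_ratio_le.
apply: measurable_set_ltr.
  apply: measurable_funM => //; apply: measurableT_comp => //.
  by apply: measurable_funD => //; exact: measurable_funM.
by apply: measurableT_comp => //; exact: measurable_funM.
Qed.

(** N is M with its entry e made constant. Given the other entries, det M
    vanishes for at most one value of that entry, unless it vanishes
    identically, and then det N is zero as well. *)
Lemma det_vanish_by_one_entry (N : T -> 'M[R]_n) :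
  (forall w k l, (k, l) != e -> N w k l = M w k l) ->
  (exists c, forall w, N w e.1 e.2 = c) ->
  P [set w | (\det (M w) == 0) && (\det (N w) != 0)] = 0%E.
Proof.
move=> NM [c Nc]; apply/eqP; rewrite eq_le measure_ge0 andbT.
have detN w : \det (N w) = c * a w + b w.
  rewrite (det_affine _ e.1 e.2) Nc /a /b.
  have e12 : (e.1, e.2) = e by rewrite -surjective_pairing.
  rewrite (eq_laplace_rest (N := M w)) => [|k l]; last by rewrite e12; exact: NM.
  rewrite (eq_cofactor (N := M w)) // => k l ki; apply: NM.
  by apply: contraNneq ki => <-.
have m1 : measurable [set z : R * others S X e | z.1 * a z.2 + b z.2 == 0].
  by apply: measurable_set_eqr => //; apply: measurable_funD => //; exact: measurable_funM.
have m2 : measurable [set z : R * others S X e | c * a z.2 + b z.2 == 0].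
  by apply: measurable_set_eqr => //; apply: measurable_funD => //; exact: measurable_funM.
have := @probability_sections_le _ T R P _ S X ind e
  ([set z | z.1 * a z.2 + b z.2 == 0] `\` [set z | c * a z.2 + b z.2 == 0]) 0%E eS.
rewrite (_ : [set w | _] = [set w | (\det (M w) == 0) && (\det (N w) != 0)]); last first.
  apply/seteqP; split => w /=; rewrite detM detN; first by case=> -> /negP ->.
  by case/andP => -> /negP.
apply; first exact: measurableD.
move=> w /=; rewrite law; last first.
  apply: measurableD; last exact: measurable_set_eqr.
  by apply: measurable_set_eqr => //; apply: measurable_funD => //; exact: measurable_funM.
rewrite /normal_prob (@integral_Sset1 R _ _ (- b w / a w)) // => x /= [/eqP h1 h2].
have a0 : a w != 0.
  by apply/eqP => a0; apply: h2; apply/eqP; move: h1; rewrite a0 !mulr0.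
by apply: (mulIf a0); rewrite divfK //; apply/eqP; rewrite -subr_eq0 opprK h1.
Qed.

End one_fresh_entry.

Section sparse_deterministic.
Context {R : realType} {n : nat}.
Implicit Types (M : 'M[R]_n) (S : {set 'I_n * 'I_n}).

Lemma sum_laplace_term_sparse S M : sparse_mx S M ->
  \sum_i \sum_j `|laplace_term M i j| = \sum_(e in S) `|laplace_term M e.1 e.2|.
Proof.
move=> SM; rewrite pair_big /= [RHS]big_mkcond /=; apply: eq_bigr => -[i j] _ /=.
by case: ifPn => // /SM; rewrite /laplace_term => ->; rewrite mul0r normr0.
Qed.

(** A sum of #|S| terms exceeding t has a term exceeding t / #|S|. *)
Lemma lt_det_cond_entry S M t : sparse_mx S M -> \det M != 0 -> (0 < #|S|)%N ->
  t < det_cond M ->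
  has (fun e => t / #|S|%:R * `|\det M| < `|laplace_term M e.1 e.2|) (enum S).
Proof.
move=> SM d0 S0; apply: contraTT; rewrite -all_predC -leNgt => /allP h.
rewrite /det_cond (sum_laplace_term_sparse SM) ler_pdivrMr ?normr_gt0 //.
apply: (@le_trans _ _ (\sum_(e in S) t / #|S|%:R * `|\det M|)).
  by apply: ler_sum => e eS; rewrite leNgt; apply: h; rewrite mem_enum.
by rewrite sumr_const -[_ *+ _]mulr_natr mulrAC divfK // pnatr_eq0 -lt0n.
Qed.

Lemma regular_row S M i : sparse_mx S M -> \det M != 0 -> exists j, (i, j) \in S.
Proof.
move=> SM; apply: contra_neqP => /forallNP nS; rewrite -(sum_laplace_term M i).
by rewrite big1 // => j _; rewrite /laplace_term SM ?mul0r //; apply/negP/nS.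
Qed.

Lemma card_rows S : #|S| = (\sum_i \sum_j ((i, j) \in S))%N.
Proof.
rewrite -sum1_card pair_big /= [LHS]big_mkcond /=.
by apply: eq_bigr => -[i j] _ /=; case: ifP.
Qed.

Lemma card_ge_size S : admissible R S -> (n <= #|S|)%N.
Proof.
move=> [M [SM]]; rewrite unitmxE unitfE => dM.
rewrite card_rows; apply: (@leq_trans (\sum_(i < n) 1)).
  by rewrite sum1_card card_ord.
apply: leq_sum => i _.
by have [j ij] := regular_row i SM dM; rewrite (bigD1 j) //= ij.
Qed.

(** Every row of S is nonempty, so #|S| = n leaves a single entry in each row;
    its term is then all of det M. *)
Lemma det_cond_size S M : admissible R S -> #|S| = n -> sparse_mx S M ->
  \det M != 0 -> det_cond M = n%:R.
Proof.
move=> [N [SN]]; rewrite unitmxE unitfE => dN cS SM dM.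
have row1 i : (1 <= \sum_j ((i, j) \in S))%N.
  by have [j ij] := regular_row i SN dN; rewrite (bigD1 j) //= ij.
have row1' i : (\sum_j ((i, j) \in S) = 1)%N.
  have n1 : n = (1 + \sum_(k < n | k != i) 1)%N.
    by rewrite -[LHS](card_ord n) -sum1_card (bigD1 i).
  have := card_rows S; rewrite cS (bigD1 i) //= => E.
  apply/eqP; rewrite eqn_leq row1 andbT -(leq_add2r (\sum_(k < n | k != i) 1)).
  apply: leq_trans (eq_leq n1); apply: leq_trans (eq_leq (esym E)).
  by rewrite leq_add2l leq_sum.
have rowsum i : \sum_j `|laplace_term M i j| = `|\det M|.
  rewrite -(sum_laplace_term M i); have [j ij] := regular_row i SN dN.
  have nj k : k != j -> laplace_term M i k = 0.
    move=> kj; rewrite /laplace_term SM ?mul0r //; apply/negP => ik.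
    by have := row1' i; rewrite (bigD1 j) //= ij (bigD1 k) //= ik.
  rewrite (bigD1 j) //= [in RHS](bigD1 j) //= !big1 ?addr0 // => k kj.
  by rewrite nj ?normr0.
rewrite /det_cond (eq_bigr (fun=> `|\det M|)) ?sumr_const ?card_ord => [|//].
by rewrite -[X in X / _]mulr_natl mulfK // normr_eq0.
Qed.

End sparse_deterministic.

Lemma probabilityU_null d (T : measurableType d) (R : realType)
    (P : probability T R) (N B : set T) :
  measurable N -> measurable B -> P N = 0%E -> (P (N `|` B) <= P B)%E.
Proof.
move=> mN mB PN; apply: (le_trans (measureU2 _ mN mB)).
rewrite -[leRHS]add0e; apply: leeD; last exact: lexx.
by move: PN => /eqP; rewrite eq_le => /andP[].
Qed.

Section sparse_random.
Context d (T : measurableType d) (R : realType) (P : probability T R) (n : nat).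
Variables (S : {set 'I_n * 'I_n}) (Abar : 'M[R]_n) (sigma : R).
Variable A : 'I_n -> 'I_n -> {RV P >-> R}.
Hypothesis n_gt0 : (0 < n)%N.
Hypothesis admS : admissible R S.
Hypothesis sigma_gt0 : 0 < sigma.
Hypothesis Abar_le1 : `|Abar| <= 1.
Hypothesis gaussA : sparse_gaussian S Abar sigma A.

Let X (e : 'I_n * 'I_n) : {RV P >-> R} := A e.1 e.2.

Lemma measurable_rand_mx i j : measurable_fun setT (fun w => rand_mx A w i j).
Proof. by under eq_fun do rewrite mxE; exact: measurable_funPT. Qed.

Let sparseA w : sparse_mx S (rand_mx A w). Proof. by case: gaussA. Qed.

(** Interpolates between the fixed matrix N (l empty) and the random one (l
    enumerating its pattern). *)
Definition hybrid_mx (N : 'M[R]_n) (l : seq ('I_n * 'I_n)) w : 'M[R]_n :=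
  \matrix_(i, j) (if (i, j) \in l then A i j w else N i j).

Lemma measurable_hybrid_mx N l i j :
  measurable_fun setT (fun w => hybrid_mx N l w i j).
Proof. under eq_fun do rewrite mxE.
case: ((i, j) \in l); [exact: measurable_funPT|exact: measurable_cst]. Qed.

Lemma measurable_det_eq0 (M : T -> 'M[R]_n) :
  (forall i j, measurable_fun setT (fun w => M w i j)) ->
  measurable [set w | \det (M w) == 0].
Proof. by move=> mM; apply: measurable_set_eqr => //; exact: measurable_det. Qed.

Lemma hybrid_det_null (N : 'M[R]_n) l :
  \det N != 0 -> uniq l -> {subset l <= S} ->
  P [set w | \det (hybrid_mx N l w) == 0] = 0%E.
Proof.
move=> dN; elim: l => [|e l IH] /=.
  move=> _ _; rewrite (_ : mkset _ = set0) ?measure0 //; apply/seteqP; split => // w /=.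
  rewrite (_ : hybrid_mx N [::] w = N) ?(negPf dN) //.
  by apply/matrixP => i j; rewrite mxE.
move=> /andP[el ul] elS.
have eS : e \in S by apply: elS; rewrite mem_head.
have lS : {subset l <= S} by move=> f fl; apply: elS; rewrite in_cons fl orbT.
have {lS}IH := IH ul lS.
pose M w := hybrid_mx N (e :: l) w.
have Me w : M w e.1 e.2 = A e.1 e.2 w by rewrite mxE -surjective_pairing mem_head.
have mM k m : (k, m) != e ->
    measurable_fun setT (fun w : others S X e => M w k m).
  move=> kme; rewrite /M; under eq_fun do rewrite mxE.
  case kml: ((k, m) \in e :: l); last exact: measurable_cst.
  exact: (@measurable_other _ T R P _ S X e (k, m) (elS _ kml) kme).
have NM w k m : (k, m) != e -> hybrid_mx N l w k m = M w k m.
  by move=> kme; rewrite !mxE in_cons (negPf kme).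
have Nc : exists c, forall w, hybrid_mx N l w e.1 e.2 = c.
  by exists (N e.1 e.2) => w; rewrite mxE -surjective_pairing (negPf el).
have null :=
  @det_vanish_by_one_entry _ T R P n S Abar sigma A gaussA e M eS Me mM _ NM Nc.
have md f := measurable_det_eq0 (measurable_hybrid_mx N f).
have mD : measurable [set w | (\det (M w) == 0) && (\det (hybrid_mx N l w) != 0)].
  rewrite (_ : mkset _ =
    [set w | \det (M w) == 0] `\` [set w | \det (hybrid_mx N l w) == 0]).
    by apply: measurableD; exact: md.
  apply/seteqP; split => w /=; first by case/andP => -> /negP.
  by case=> -> /negP.
apply/eqP; rewrite eq_le measure_ge0 andbT.
apply: (@le_trans _ _ (P ([set w | \det (hybrid_mx N l w) == 0] `|`
    [set w | (\det (M w) == 0) && (\det (hybrid_mx N l w) != 0)]))).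
  apply: le_measure; rewrite ?inE; [exact: md|by apply: measurableU => //; exact: md|].
  by move=> w /= Mw; rewrite /M Mw /=; case: eqVneq; [left|right].
by apply: (le_trans (probabilityU_null (md _) mD IH)); rewrite null.
Qed.

Lemma rand_det_null : P [set w | \det (rand_mx A w) == 0] = 0%E.
Proof.
have [N [SN]] := admS; rewrite unitmxE unitfE => dN.
have S1 : {subset enum S <= S} by move=> e; rewrite mem_enum.
rewrite -[RHS](hybrid_det_null dN (enum_uniq S) S1); congr (P _).
apply/seteqP; suff E w : rand_mx A w = hybrid_mx N (enum S) w.
  by split => w /=; rewrite E.
apply/matrixP => i j; rewrite [RHS]mxE mem_enum; case: ifPn => [_|ijS].
  by rewrite mxE.
by rewrite sparseA // SN.
Qed.

Lemma card_gt0 : (0 < #|S|)%N.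
Proof. exact: leq_trans n_gt0 (card_ge_size admS). Qed.

(** Stated for an arbitrary event F, as it is used both for the condition number
    and for its truncation from below by 1. *)
Lemma tail_event_le (F : set T) t : measurable F -> #|S|%:R < t ->
  (forall w, F w -> \det (rand_mx A w) != 0 -> t < det_cond (rand_mx A w)) ->
  (P F <= ((1 + 3 / 4 * sigma) / sigma * (#|S|%:R ^+ 2 / (t - #|S|%:R)) *
       Num.sqrt (2 / pi))%:E)%E.
Proof.
move=> mF St Ft; have m0 : 0 < #|S|%:R :> R by rewrite ltr0n card_gt0.
pose Q (e : 'I_n * 'I_n) w :=
  t / #|S|%:R * `|\det (rand_mx A w)| < `|laplace_term (rand_mx A w) e.1 e.2|.
have mrA := measurable_rand_mx.
have mQ e : e \in enum S -> measurable [set w | Q e w].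
  move=> _; apply: measurable_set_ltr.
    apply: measurable_funM => //; apply: measurableT_comp => //.
    exact: measurable_det.
  by apply: measurableT_comp => //; exact: measurable_laplace_term.
have md := measurable_det_eq0 mrA.
apply: (@le_trans _ _
  (P ([set w | \det (rand_mx A w) == 0] `|` [set w | has (Q^~ w) (enum S)]))).
  apply: le_measure; rewrite ?inE //.
    by apply: measurableU => //; exact: measurable_set_has.
  move=> w Fw /=; case: (eqVneq (\det (rand_mx A w)) 0) => [|d0]; [by left|right].
  by apply: lt_det_cond_entry => //; [exact: card_gt0|exact: Ft].
apply: (le_trans (probabilityU_null md (measurable_set_has mQ) rand_det_null)).
apply: (le_trans (measure_has_le P mQ)).
have t1 : 1 < t / #|S|%:R by rewrite ltr_pdivlMr // mul1r.
apply: (@le_trans _ _ (\sum_(e <- enum S)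
  ((1 + 3 / 4 * sigma) / sigma * Num.sqrt (2 / pi) / (t / #|S|%:R - 1))%:E)%E).
  rewrite big_seq [leRHS]big_seq; apply: lee_sum => e; rewrite mem_enum => eS.
  apply: (@laplace_ratio_tail_le _ T R P n S Abar sigma A sigma_gt0 Abar_le1
    gaussA e (rand_mx A)) => //.
    by move=> w; rewrite mxE.
  move=> k l kle.
  have -> : (fun w : others S X e => rand_mx A w k l) = (A k l : T -> R).
    by apply/funext => w; rewrite mxE.
  case klS : ((k, l) \in S).
    exact: (@measurable_other _ T R P _ S X e (k, l) klS kle).
  rewrite (_ : (A k l : T -> R) = cst 0); first exact: measurable_cst.
  by apply/funext => w; have := @sparseA w k l; rewrite mxE klS; apply.
rewrite sumEFin big_enum sumr_const -mulr_natr lee_fin le_eqVlt.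
apply/orP; left; apply/eqP.
move: (@pi R) => p; move: #|S| m0 St t1 => m m0 St t1.
by field; rewrite !gt_eqF ?subr_gt0.
Qed.

End sparse_random.

(** * Expectation of a logarithm from a tail bound *)

Lemma within_continuous_geometric_tail (R : realType) (rho : R) : 0 < rho < 1 ->
  {within `[0, +oo[, continuous
    (fun s : R => rho * expR (- s) / (1 - rho * expR (- s)))}.
Proof.
move=> /andP[rho0 rho1].
have ce : continuous (fun s : R => rho * expR (- s)).
  move=> s; apply: cvgM; first exact: cvg_cst.
  by apply: (continuous_cvg _ _ (@cvgN R R^o _ _ _ id s cvg_id)); exact: continuous_expR.
apply: continuous_in_subspaceT => s; rewrite inE /= in_itv /= andbT => s0.
apply: cvgM; first exact: ce.
apply: cvgV; last by apply: cvgB; [exact: cvg_cst|exact: ce].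
rewrite gt_eqF // subr_gt0 (le_lt_trans _ rho1) // ler_piMr ?(ltW rho0) //.
by rewrite -expR0 ler_expR oppr_le0.
Qed.

(** The antiderivative is ln (1 - rho * expR (- s)), which tends to 0 at
    infinity. *)
Lemma integral_geometric_tail (R : realType) (rho : R) : 0 < rho < 1 ->
  (\int[lebesgue_measure]_(s in `[0%R, +oo[)
     (rho * expR (- s) / (1 - rho * expR (- s)))%:E = (- ln (1 - rho))%:E)%E.
Proof.
move=> /andP[rho0 rho1].
have q1 (s : R) : 0 <= s -> rho * expR (- s) < 1.
  move=> s0; apply: le_lt_trans rho1; rewrite ler_piMr ?(ltW rho0) //.
  by rewrite -expR0 ler_expR oppr_le0.
have q0 s : 0 < rho * expR (- s) by rewrite mulr_gt0 ?expR_gt0.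
pose g : R -> R := fun s => 1 - rho * expR (- s).
pose F (s : R) := ln (g s).
pose f (s : R) := rho * expR (- s) / g s.
have g0 (s : R) : 0 <= s -> 0 < g s by move=> s0; rewrite subr_gt0 q1.
have dg (s : R) : is_derive s 1 g (rho * expR (- s)).
  have de := is_derive1_comp (is_derive_expR (- s)) (is_deriveNid s 1).
  have dB := is_deriveB (is_derive_cst (1 : R^o) (s : R^o) 1) (is_deriveZ rho de).
  by apply: (is_derive_eq dB); rewrite sub0r mulrN1 scalerN opprK.
have dF (s : R) : 0 <= s -> is_derive s 1 F (f s).
  move=> s0; have dc := is_derive1_comp (is_derive1_ln (g0 _ s0)) (dg s).
  by apply: (is_derive_eq dc); rewrite mulrC.
have cF (s : R) : 0 <= s -> {for s, continuous F}.
  move=> s0; apply: differentiable_continuous; apply/derivable1_diffP.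
  by case: (dF s s0).
rewrite (@ge0_continuous_FTC2y R f F 0 0) //.
- by rewrite /F /g oppr0 expR0 mulr1 sub0e EFinN.
- by move=> s s0; rewrite divr_ge0 ?(ltW (g0 _ s0)) ?(ltW (q0 s)).
- by apply: within_continuous_geometric_tail; rewrite rho0.
- have gy : g s @[s --> +oo] --> (1 : R).
    rewrite -[X in _ --> X](subr0 1) -(mulr0 rho).
    apply: cvgB; first exact: cvg_cst.
    by apply: cvgM; [exact: cvg_cst|exact: cvgr_expR].
  rewrite -[X in _ --> X](@ln1 R).
  by apply: (continuous_cvg _ _ gy); exact: continuous_ln.
- by move=> s s0; case: (dF s (ltW s0)).
- by apply: cvg_at_right_filter; exact: cF.
- move=> s; rewrite in_itv /= andbT => s0; rewrite derive1E.
  by case: (dF s (ltW s0)).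
Qed.

(** The difference of the two sides has derivative r - ln (1 + r) >= 0. *)
Lemma mul_ln1D_le (R : realType) (r : R) : 0 < r ->
  (1 + r) * ln (1 + r) <= r + r ^+ 2 / 2.
Proof.
move=> r0.
pose h : R -> R := fun x => (1 + x) * ln (1 + x) - x ^+ 2 / 2 - x.
have dh (x : R) : 0 <= x -> is_derive x 1 h (ln (1 + x) - x).
  move=> x0; have x1 : 0 < 1 + x by lra.
  have d1 : is_derive x 1 (fun x : R => 1 + x) 1.
    have dD := is_deriveD (is_derive_cst (1 : R^o) (x : R^o) 1) (is_derive_id (x : R^o) 1).
    by apply: (is_derive_eq dD); rewrite add0r.
  have dl := is_derive1_comp (is_derive1_ln x1) d1.
  have dM := is_deriveM d1 dl.
  have dX := is_deriveZ (2^-1 : R) (is_deriveX 2 (is_derive_id (x : R^o) 1)).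
  have dB := is_deriveB (is_deriveB dM dX) (is_derive_id (x : R^o) 1).
  have -> : h = (fun x0 => 1 + x0) * (ln (R:=R) \o +%R 1) - 2^-1 \*: (id ^+ 2) - id.
    by apply/funext => y; rewrite /h /= !fctE /=; rewrite [_ / 2]mulrC.
  apply: (is_derive_eq dB); rewrite /GRing.scale /=; field.
  by rewrite gt_eqF.
have [x||c] := @MVT R h (fun x => ln (1 + x) - x) 0 r r0.
- by rewrite in_itv /= => /andP[x0 _]; exact: dh (ltW x0).
- apply: continuous_in_subspaceT => x; rewrite inE /= in_itv /= => /andP[x0 _].
  by apply: differentiable_continuous; apply/derivable1_diffP; case: (dh x x0).
rewrite in_itv /= => /andP[c0 _]; rewrite subr0 {2}/h addr0 ln1 => E.
have lc : ln (1 + c) <= c by apply: le_ln1Dx; lra.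
have : h r <= 0.
  by move: E; rewrite mulr0 expr0n /= mul0r !subr0 => ->; nra.
by rewrite /h; lra.
Qed.

(** Above ln (B + m) the expectation is the integral of the tail
    P(ln Z - ln (B + m) > s) <= B / ((B + m) * expR s - m), a multiple of the
    integrand of [integral_geometric_tail] with rho = m / (B + m). *)
Lemma integral_ln_le d (T : measurableType d) (R : realType)
    (P : probability T R) (Z : {RV P >-> R}) (m B : R) :
  (forall w, 1 <= Z w) -> 1 <= m -> 0 < B ->
  (forall t, m < t -> (P [set w | t < Z w]%R <= (B / (t - m))%:E)%E) ->
  (\int[P]_w (ln (Z w))%:E <= (ln B + 1 + m / (2 * B))%:E)%E.
Proof.
move=> Z1 m1 B0 tail; have m0 : 0 < m by lra.
(* the point where the tail bound equals 1 *)
pose t0 := B + m; have t00 : 0 < t0 by rewrite addr_gt0.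
have lt0 : 0 <= ln t0 by rewrite ln_ge0 // /t0; lra.
pose rho := m / t0.
have rho01 : 0 < rho < 1 by rewrite divr_gt0 //= ltr_pdivrMr // mul1r /t0; lra.
have mlnZ : measurable_fun setT (fun w => ln (Z w)).
  exact: (measurableT_comp (@measurable_ln R) (measurable_funPT Z)).
pose W w := Num.max 0 (ln (Z w) - ln t0).
have mW : measurable_fun setT W.
  by apply: measurable_maxr => //; exact: measurable_funB.
have W0 w : 0 <= W w by rewrite le_max lexx.
pose W' : {RV P >-> R} := mfun_Sub (mem_set mW).
have EW : (\int[P]_w (W w)%:E <= (B / m * - ln (1 - rho))%:E)%E.
  have -> : (\int[P]_w (W w)%:E = 'E_P[W'])%E by rewrite expectation_def.
  rewrite ge0_expectation_ccdf // EFinM -(integral_geometric_tail rho01).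
  have q1 (s : R) : 0 <= s -> 0 < 1 - rho * expR (- s).
    case/andP: rho01 => r0 r1 s0; rewrite subr_gt0 (le_lt_trans _ r1) //.
    by rewrite ler_piMr ?(ltW r0) // -expR0 ler_expR oppr_le0.
  have f0 (s : R) : 0 <= s -> 0 <= rho * expR (- s) / (1 - rho * expR (- s)).
    case/andP: rho01 => r0 r1 s0.
    apply: divr_ge0; last exact: ltW (q1 _ s0).
    by rewrite mulr_ge0 ?expR_ge0 // ltW.
  have mf : measurable_fun (`[0%R, +oo[%classic : set R)
      (fun s : R => (rho * expR (- s) / (1 - rho * expR (- s)))%:E).
    apply/measurable_EFinP; apply: subspace_continuous_measurable_fun => //.
    exact: within_continuous_geometric_tail.
  rewrite -ge0_integralZl //; last 2 first.
  - by move=> s; rewrite /= in_itv /= andbT lee_fin => /f0.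
  - by rewrite lee_fin divr_ge0 ?ltW.
  apply: ge0_le_integral => //.
  - by apply: measurable_funTS; exact: ccdf_measurable.
  - by apply: emeasurable_funM => //; exact: measurable_cst.
  move=> s; rewrite /= in_itv /= andbT => s0.
  have e1 : 1 <= expR s by rewrite -expR0 ler_expR.
  have te : m < t0 * expR s by rewrite /t0; nra.
  have : (P [set w | t0 * expR s < Z w]%R <= (B / (t0 * expR s - m))%:E)%E by exact: tail.
  have ltZ w : (s < W w) = (t0 * expR s < Z w).
    have Z0 : 0 < Z w by apply: lt_le_trans (Z1 w).
    by rewrite /W lt_max ltNge s0 /= ltrBrDl -[in LHS]ltr_expR expRD !lnK ?posrE.
  have -> : ccdf W' s = P [set w | t0 * expR s < Z w].
    congr (P _); apply/seteqP; split => w /=; rewrite in_itv /= andbT /W /=.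
      by rewrite -ltZ.
    by rewrite ltZ.
  move=> h; apply: (le_trans h); rewrite -EFinM lee_fin le_eqVlt; apply/orP; left.
  apply/eqP; rewrite /rho expRN; field.
  by rewrite !gt_eqF ?expR_gt0 ?subr_gt0.
have lnZW w : ((ln (Z w))%:E <= (ln t0)%:E + (W w)%:E)%E.
  by rewrite -EFinD lee_fin -lerBlDl /W le_max lexx orbT.
apply: (@le_trans _ _ (\int[P]_w ((ln t0)%:E + (W w)%:E))%E).
  apply: ge0_le_integral => //.
  - by move=> w _; rewrite lee_fin ln_ge0.
  - exact/measurable_EFinP.
  - by apply/measurable_EFinP; apply: measurable_funD.
rewrite ge0_integralD //; last 2 first.
  - by move=> w _; rewrite lee_fin.
  - exact/measurable_EFinP.
have PT : (P setT = 1)%E by exact: probability_setT.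
have -> : (\int[P]_w (ln t0)%:E = (ln t0)%:E * P setT)%E.
  exact: (integral_cst P measurableT (ln t0)%:E).
rewrite PT mule1.
apply: (le_trans (leeD2l _ EW)); rewrite -EFinD lee_fin.
pose r := m / B; have r0 : 0 < r by rewrite divr_gt0.
have -> : 1 - rho = (1 + r)^-1.
  by rewrite /rho /r /t0; field; rewrite !gt_eqF // addr_gt0.
have -> : t0 = B * (1 + r) by rewrite /t0 /r; field; rewrite gt_eqF.
have r1 : 0 < 1 + r by lra.
rewrite lnV ?posrE // opprK lnM ?posrE //.
have -> : B / m = r^-1 by rewrite /r invf_div.
have -> : m / (2 * B) = r / 2 by rewrite /r; field; rewrite gt_eqF.
have := mul_ln1D_le r0; set l := ln (1 + r) => h.
have : r^-1 * ((1 + r) * l) <= r^-1 * (r + r ^+ 2 / 2).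
  by rewrite ler_pM2l // invr_gt0.
have -> : r^-1 * ((1 + r) * l) = l + r^-1 * l by field; rewrite gt_eqF.
have -> : r^-1 * (r + r ^+ 2 / 2) = 1 + r / 2 by field; rewrite gt_eqF.
lra.
Qed.

(** * Tail and expected logarithm of the condition number *)

Lemma ge3_of_between_square (k l : nat) :
  (0 < k)%N -> (k <= l)%N -> (l <= k * k)%N -> l != k -> (3 <= l)%N.
Proof. nia. Qed.

(** Put x = sqrt (2 / pi). As ln x <= x - 1 and 2 q m >= 6, the claim reduces to
    x + 1 / (6 x) < 103 / 100, which holds for 1 / 2 <= x ^ 2 <= 2 / 3, that is
    for 3 <= pi <= 4. *)
Lemma log_constant_lt (R : realType) (q m : R) : 1 < q -> 3 <= m ->
  let B := q * m ^+ 2 * Num.sqrt (2 / pi) in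
  ln B + 1 + m / (2 * B) < ln q + 2 * ln m + 103 / 100.
Proof.
move=> q1 m3 /=; have q0 : 0 < q by lra.
have m0 : 0 < m by lra.
pose x : R := Num.sqrt (2 / pi); have xp : 0 < x by rewrite sqrtr_gt0 divr_gt0 ?pi_gt0.
have x2 : 1 / 2 <= x ^+ 2 <= 2 / 3.
  have p3 := @pi_ge3 R; have p4 := pihalf_lt2 R.
  rewrite /x sqr_sqrtr ?divr_ge0 ?pi_ge0 //.
  by rewrite ler_pdivlMr ?pi_gt0 // ler_pdivrMr ?pi_gt0 //; apply/andP; split; lra.
have xl : 7 / 10 <= x by case/andP: x2 => ? _; nra.
have xu : x <= 82 / 100 by case/andP: x2 => _ ?; nra.
have lx : ln x <= x - 1.
  have -> : ln x = ln (1 + (x - 1)) by congr ln; lra.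
  by apply: le_ln1Dx; lra.
rewrite -/x expr2 !lnM ?posrE ?mulr_gt0 //.
have mB : m / (2 * (q * (m * m) * x)) <= 1 / (6 * x).
  rewrite ler_pdivrMr ?mulr_gt0 //.
  rewrite mulrAC ler_pdivlMr ?mulr_gt0 //.
  have qm : 3 <= q * m by apply: (le_trans m3); rewrite ler_peMl // ltW.
  have mx : 0 < m * x by rewrite mulr_gt0.
  have := ler_wpM2r (ltW mx) qm; lra.
have mx : x + 1 / (6 * x) < 103 / 100.
  have -> : x + 1 / (6 * x) = (x ^+ 2 + 1 / 6) / x by field; rewrite gt_eqF.
  by rewrite ltr_pdivrMr //; nra.
lra.
Qed.

Section cond_det_estimates.
Context d (T : measurableType d) (R : realType) (P : probability T R) (n : nat).
Variables (S : {set 'I_n * 'I_n}) (Abar : 'M[R]_n) (sigma : R).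
Variable A : 'I_n -> 'I_n -> {RV P >-> R}.
Hypothesis n_gt0 : (0 < n)%N.
Hypothesis admS : admissible R S.
Hypothesis sigma_gt0 : 0 < sigma.
Hypothesis Abar_le1 : `|Abar| <= 1.
Hypothesis gaussA : sparse_gaussian S Abar sigma A.

Let m : R := #|S|%:R.
Let q : R := (1 + sigma) / sigma.
Let m1 : 1 <= m. Proof. by rewrite ler1n; exact: card_gt0 admS. Qed.
Let q1 : 1 < q. Proof. by rewrite /q ltr_pdivlMr // mul1r ltrDr. Qed.
Let x0 : 0 < Num.sqrt (2 / pi) :> R.
Proof. by rewrite sqrtr_gt0 divr_gt0 // pi_gt0. Qed.

Lemma tail_bound_lt t : m < t ->
  (1 + 3 / 4 * sigma) / sigma * (m ^+ 2 / (t - m)) * Num.sqrt (2 / pi) <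
  q * (m ^+ 2 / (t - m)) * Num.sqrt (2 / pi).
Proof.
move=> mt; rewrite ltr_pM2r // ltr_pM2r; last first.
  by rewrite divr_gt0 ?subr_gt0 // exprn_gt0 // (lt_le_trans ltr01).
by rewrite /q ltr_pM2r ?invr_gt0 // ltrD2l gtr_pMl //; lra.
Qed.

Lemma cond_det_tail t : m < t ->
  (P [set w | t%:E < cond_det (rand_mx A w)] <
   (q * (m ^+ 2 / (t - m)) * Num.sqrt (2 / pi))%:E)%E.
Proof.
move=> mt; apply: (@le_lt_trans _ _ ((1 + 3 / 4 * sigma) / sigma *
  (m ^+ 2 / (t - m)) * Num.sqrt (2 / pi))%:E%E); last first.
  by rewrite lte_fin; exact: tail_bound_lt.
apply: (tail_event_le n_gt0 admS sigma_gt0 Abar_le1 gaussA) => //.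
  have mE : measurable_fun setT (fun r : R => r%:E).
    by apply/measurable_EFinP; exact: measurable_id.
  have mc := @measurable_comp_cond_det _ T R n (rand_mx A) id n_gt0
    (measurable_rand_mx A) mE.
  rewrite -[X in measurable X]setTI.
  have := measurable_fun_lte (measurable_cst t%:E) mc.
  by move=> /(_ measurableT [set true] I).
by move=> w /= tc d0; rewrite -lte_fin -cond_det_regular.
Qed.

(** Almost surely the condition number; the truncation only changes the null
    set where the determinant vanishes, so that Z >= 1 everywhere. *)
Let Z w := Num.max 1 (det_cond (rand_mx A w)).

Let mZ : measurable_fun setT Z.
Proof.
apply: measurable_maxr => //; apply: measurable_det_cond; exact: measurable_rand_mx.
Qed.

Let Z1 w : 1 <= Z w. Proof. by rewrite le_max lexx. Qed.

Let Z_regular w : \det (rand_mx A w) != 0 -> Z w = det_cond (rand_mx A w).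
Proof.
move=> d0; apply/max_idPr; apply: le_trans (det_cond_ge d0).
by rewrite ler1n.
Qed.

Lemma integral_loge_cond_det beta : 1 < beta ->
  (\int[P]_w loge beta (cond_det (rand_mx A w)) =
   (ln beta)^-1%:E * \int[P]_w (ln (Z w))%:E)%E.
Proof.
move=> b1; have lb : 0 < ln beta by rewrite ln_gt0.
have mlnZ : measurable_fun setT (fun w => ln (Z w)).
  exact: (measurableT_comp (@measurable_ln R) mZ).
rewrite -ge0_integralZl //; last 3 first.
- exact/measurable_EFinP.
- by move=> w _; rewrite lee_fin ln_ge0.
- by rewrite lee_fin invr_ge0 ltW.
apply: ae_eq_integral => //.
- apply: measurable_comp_cond_det => //; first exact: measurable_rand_mx.
  apply: emeasurable_funM; last exact: measurable_cst.
  apply: measurable_fun_ifT => //.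
    exact: measurable_fun_ler.
  by apply/measurable_EFinP; exact: measurable_ln.
- by apply: emeasurable_funM; [exact: measurable_cst|exact/measurable_EFinP].
exists [set w | \det (rand_mx A w) == 0]; split.
- by apply: measurable_det_eq0; exact: measurable_rand_mx.
- exact: (rand_det_null admS gaussA).
move=> w /= /existsNP[_ h]; apply/negPn/negP => d0; apply: h.
rewrite cond_det_regular // -Z_regular // /loge lne_EFin ?(lt_le_trans _ (Z1 w)) //.
by rewrite inver gt_eqF // muleC.
Qed.

(** When #|S| = n, Z is at most n = #|S|. Otherwise n < #|S| <= n ^ 2 forces
    #|S| >= 3, and the tail bound gives the estimate. *)
Lemma integral_ln_cond_lt :
  (\int[P]_w (ln (Z w))%:E < (ln q + 2 * ln m + 103 / 100)%:E)%E.
Proof.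
have m0 : 0 < m := lt_le_trans ltr01 m1.
have lq : 0 < ln q by rewrite ln_gt0.
have lm : 0 <= ln m by rewrite ln_ge0.
have mlnZ : measurable_fun setT (fun w => ln (Z w)).
  exact: (measurableT_comp (@measurable_ln R) mZ).
have [Sn|Sn] := eqVneq #|S| n.
  apply: (@le_lt_trans _ _ (ln m)%:E); last by rewrite lte_fin; lra.
  have <- : (\int[P]_w (ln m)%:E = (ln m)%:E)%E.
    have PT : (P setT = 1)%E by exact: probability_setT.
    by rewrite -[RHS]mule1 -PT; exact: (integral_cst P measurableT (ln m)%:E).
  apply: ge0_le_integral => //.
  - by move=> w _; rewrite lee_fin ln_ge0.
  - exact/measurable_EFinP.
  move=> w _; rewrite lee_fin ler_ln ?posrE // ?(lt_le_trans _ (Z1 w)) //.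
  rewrite ge_max m1 /=; have [d0|d0] := eqVneq (\det (rand_mx A w)) 0.
    by rewrite /det_cond d0 normr0 invr0 mulr0 ltW.
  have sparseA : sparse_mx S (rand_mx A w) by case: gaussA.
  by rewrite (det_cond_size admS Sn sparseA d0) /m Sn.
have m3 : 3 <= m.
  have Sle : (#|S| <= n * n)%N by have := max_card (mem S); rewrite card_prod card_ord.
  by rewrite (ler_nat _ 3) (ge3_of_between_square n_gt0 (card_ge_size admS)).
pose B := q * m ^+ 2 * Num.sqrt (2 / pi).
have q0 : 0 < q := lt_trans ltr01 q1.
have B0 : 0 < B by rewrite mulr_gt0 // mulr_gt0 // exprn_gt0.
pose Z' : {RV P >-> R} := mfun_Sub (mem_set mZ).
apply: (@le_lt_trans _ _ (ln B + 1 + m / (2 * B))%:E).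
  apply: (@integral_ln_le _ T R P Z' m B) => // t mt.
  apply: (@le_trans _ _ ((1 + 3 / 4 * sigma) / sigma *
    (m ^+ 2 / (t - m)) * Num.sqrt (2 / pi))%:E%E); last first.
    rewrite lee_fin (_ : B / (t - m) = q * (m ^+ 2 / (t - m)) * Num.sqrt (2 / pi)).
      exact: ltW (tail_bound_lt mt).
    by rewrite /B; field; rewrite gt_eqF // subr_gt0.
  apply: (tail_event_le n_gt0 admS sigma_gt0 Abar_le1 gaussA) => //.
    by apply: measurable_set_ltr => //; exact: measurable_cst.
  by move=> w /= + d0; rewrite Z_regular.
by rewrite lte_fin; exact: log_constant_lt.
Qed.

Lemma expectation_loge_cond_det beta : 1 < beta ->
  (\int[P]_w loge beta (cond_det (rand_mx A w)) <
   (logr beta q + 2 * logr beta m + 103 / 100 / ln beta)%:E)%E.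
Proof.
move=> b1; have lb : 0 < ln beta by rewrite ln_gt0.
rewrite integral_loge_cond_det // /logr.
have -> : ln q / ln beta + 2 * (ln m / ln beta) + 103 / 100 / ln beta =
  (ln beta)^-1 * (ln q + 2 * ln m + 103 / 100) by field; rewrite gt_eqF.
rewrite EFinM lte_pmul2l ?lte_fin ?invr_gt0 //.
exact: integral_ln_cond_lt.
Qed.

End cond_det_estimates.

Theorem theorem2 (R : realType) (d : measure_display) (T : measurableType d)
    (P : probability T R) (n : nat) (S : {set 'I_n * 'I_n})
    (Abar : 'M[R]_n) (sigma : R) (A : 'I_n -> 'I_n -> {RV P >-> R}) :
  (1 <= n)%N ->
  admissible R S ->
  sparse_mx S Abar ->
  `|Abar| <= 1 ->
  0 < sigma ->
  sparse_gaussian S Abar sigma A ->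
  (forall t : R, #|S|%:R < t ->
     (P [set w | t%:E < cond_det (rand_mx A w)] <
      ((1 + sigma) / sigma * (#|S|%:R ^+ 2 / (t - #|S|%:R)) *
       Num.sqrt (2 / pi))%R%:E)%E) /\
  (forall beta : R, 1 < beta ->
     (\int[P]_w loge beta (cond_det (rand_mx A w)) <
      (logr beta ((1 + sigma) / sigma) + 2 * logr beta #|S|%:R +
       103 / 100 / ln beta)%R%:E)%E).
Proof.
move=> n1 admS _ A1 s0 gA; split => [t|beta].
  exact: (cond_det_tail n1 admS s0 A1 gA).
exact: (expectation_loge_cond_det n1 admS s0 A1 gA).
Qed.
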